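(* Let $k$ be a field, let $\Lambda$ be a finite dimensional symmetric periodic $k$-algebra with Jacobson radical $\mathfrak{r}$, and suppose that $\Lambda/\mathfrak{r}\otimes_k\Lambda/\mathfrak{r}$ is semisimple. Then for all finitely generated left $\Lambda$-modules $M,N$, the following are equivalent: (i) $\operatorname{Ext}_{\Lambda}^i(M,N)=0$ for $i\gg0$. (ii) $\operatorname{Ext}_{\Lambda}^i(M,N)=0$ for $i>0$. (iii) $\operatorname{Ext}_{\Lambda}^i(N,M)=0$ for $i\gg0$. (iv) $\operatorname{Ext}_{\Lambda}^i(N,M)=0$ for $i>0$.
   Context: A finite dimensional $k$-algebra $\Lambda$ is symmetric if there is an isomorphism $\Lambda\simeq\operatorname{Hom}_k(\Lambda,k)$ of $\Lambda$-$\Lambda$-bimodules. Let $\Lambda^{\mathrm{e}}=\Lambda\otimes_k\Lambda^{\mathrm{op}}$ be the enveloping algebra. $\Lambda$ is periodic if there is an integer $p>0$ such that $\Lambda\simeq\Omega_{\Lambda^{\mathrm{e}}}^p(\Lambda)$ as left $\Lambda^{\mathrm{e}}$-modules (i.e. as bimodules), where $\Omega_{\Lambda^{\mathrm{e}}}^p(\Lambda)$ is the $p$th syzygy in the minimal projective $\Lambda^{\mathrm{e}}$-resolution of $\Lambda$. *)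

(* Defs.v *)
From HB Require Import structures.
From mathcomp Require Import all_boot all_order all_algebra.
From mathcomp Require Import falgebra boolp.
From mathcomp Require Import finmap monalg.

Set Implicit Arguments.
Unset Strict Implicit.
Unset Printing Implicit Defensive.

Import GRing.Theory.

Local Open Scope ring_scope.

(** Modules are left modules.  Submodules are boolean predicates satisfying
    [submod_closed]; by [boolp], every [Prop]-valued submodule is of this
    form. *)

Section Modules.
Variable R : pzRingType.
Implicit Types U V M N P : lmodType R.

Definition fin_gen M : Prop :=
  exists n (e : 'I_n -> M), forall x, exists c : 'I_n -> R,
    x = \sum_(i < n) c i *: e i.

Definition mod_iso U V : Prop := exists f : {linear U -> V}, bijective f.

Definition surj (U V : Type) (f : U -> V) : Prop := forall v, exists u, f u = v.

Definition projective P : Prop :=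
  forall U V (g : {linear U -> V}) (f : {linear P -> V}),
    surj g -> exists h : {linear P -> U}, forall x, g (h x) = f x.

Definition sum_full M (S T : {pred M}) : Prop :=
  forall x, exists2 s, s \in S & exists2 t, t \in T & x = s + t.

Definition superfluous M (S : {pred M}) : Prop :=
  forall T : {pred M}, submod_closed T -> sum_full S T -> forall x, x \in T.

Definition semisimple_mod M : Prop :=
  forall S : {pred M}, submod_closed S ->
    exists T : {pred M}, [/\ submod_closed T, sum_full S T &
      forall x, x \in S -> x \in T -> x = 0].

Definition ker_pred U V (f : {linear U -> V}) : {pred U} :=
  [pred x | f x == 0].

Lemma ker_submod_closed U V (f : {linear U -> V}) :
  submod_closed (ker_pred f).
Proof.
split=> [|a x y]; first by rewrite inE linear0.
by rewrite !inE linearP => /eqP-> /eqP->; rewrite scaler0 addr0.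
Qed.

HB.instance Definition _ U V (f : {linear U -> V}) :=
  GRing.isSubmodClosed.Build R U (ker_pred f)
    (GRing.submod_closed_semi (ker_submod_closed f)).

Definition kermod U V (f : {linear U -> V}) := {x : U | x \in ker_pred f}.
HB.instance Definition _ U V (f : {linear U -> V}) :=
  SubChoice.on (kermod f).
HB.instance Definition _ U V (f : {linear U -> V}) :=
  [SubChoice_isSubLmodule of kermod f by <:].

(** [... -> P 2 -> P 1 -> P 0 -> M -> 0], with [res_diff n : P n.+1 -> P n]. *)
Record proj_resolution M := ProjResolution {
  res_obj :> nat -> lmodType R;
  res_aug : {linear res_obj 0 -> M};
  res_diff : forall n, {linear res_obj n.+1 -> res_obj n};
  res_proj : forall n, projective (res_obj n);
  res_aug_surj : surj res_aug;
  res_exact0 : forall x, res_aug x = 0 <-> exists y, res_diff 0 y = x;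
  res_exactS : forall n x,
    res_diff n x = 0 <-> exists y, res_diff n.+1 y = x
}.

(** A projective resolution is minimal when each [P n] is a projective cover
    of the kernel (of [M] if [n = 0]) onto which it maps.  For finitely
    generated modules over a finite dimensional algebra such a resolution
    exists and is unique up to isomorphism, so that [syzygy P n] is then
    independent of the choice of [P]. *)
Definition minimal_resolution M (P : proj_resolution M) : Prop :=
  superfluous (ker_pred (res_aug P)) /\
  forall n, superfluous (ker_pred (res_diff P n)).

Definition syzygy M (P : proj_resolution M) (n : nat) : lmodType R :=
  match n with
  | 0 => M
  | 1 => kermod (res_aug P)
  | m.+2 => kermod (res_diff P m)
  end.

(** The vanishing of the [i]-th cohomology group of the complex
    [Hom(P 0, N) -> Hom(P 1, N) -> ...]: every cocycle is a coboundary. *)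
Definition cohomology_eq0 M (P : proj_resolution M) N (i : nat) : Prop :=
  match i with
  | 0 => forall f : {linear P 0 -> N},
           (forall x, f (res_diff P 0 x) = 0) -> forall x, f x = 0
  | j.+1 => forall f : {linear P j.+1 -> N},
           (forall x, f (res_diff P j.+1 x) = 0) ->
           exists g : {linear P j -> N}, forall x, f x = g (res_diff P j x)
  end.

(** [Ext^i(M, N) = 0].  Up to isomorphism, the cohomology does not depend on
    the resolution; see [proj_resolution_exists] for existence. *)
Definition Ext_eq0 (i : nat) M N : Prop :=
  forall P : proj_resolution M, cohomology_eq0 P N i.
End Modules.

Section FreeResolution.
Variable R : nzRingType.

Section Free.
Variable K : choiceType.
Local Notation F := (malg K R : lmodType R).

Section Lift.
Variables (N : lmodType R) (h : K -> N).

Definition free_lift (g : F) : N :=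
  \sum_(k <- enum_fset (msupp g)) g@_k *: h k.

Lemma free_liftEw (g : F) (d : finSet K) :
  fsubset (msupp g) d ->
  free_lift g = \sum_(k <- enum_fset d) g@_k *: h k.
Proof.
move=> gd; rewrite /free_lift; apply: big_fset_incl => // k _ kg.
by rewrite mcoeff_outdom ?scale0r.
Qed.

Lemma free_lift_is_linear : linear free_lift.
Proof.
move=> a x y.
pose d := fsetU (msupp x) (msupp y).
have xd : fsubset (msupp x) d by apply: fsubsetUl.
have yd : fsubset (msupp y) d by apply: fsubsetUr.
have zd : fsubset (msupp (a *: x + y)) d.
  apply: (fsubset_trans (msuppD_le _ _)).
  by apply: fsetSU; apply: msuppZ_le.
rewrite (free_liftEw xd) (free_liftEw yd) (free_liftEw zd).
rewrite scaler_sumr -big_split; apply: eq_bigr => k _ /=.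
by rewrite mcoeffD mcoeffZ scalerDl scalerA.
Qed.

HB.instance Definition _ :=
  GRing.isLinear.Build R F N _ free_lift free_lift_is_linear.

Lemma free_liftU k : free_lift (mkmalgU k 1) = h k.
Proof.
by rewrite (free_liftEw (msuppU_le)) big_seq_fset1
           mcoeffUU scale1r.
Qed.
End Lift.

Lemma free_projective : projective F.
Proof.
move=> U V g f gsurj.
have [h hP] : {h : K -> U & forall k, g (h k) = f (mkmalgU k 1)}.
  by apply: (@choice _ _ (fun k u => g u = f (mkmalgU k 1))).
exists (free_lift h : {linear F -> U}) => x.
have xE : x = free_lift (fun k => mkmalgU k 1 : F) x.
  rewrite {1}[x]monalgE; apply: eq_bigr => k _.
  apply/malgP => l.
  by rewrite mcoeffZ !mcoeffU mulr_natr.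
rewrite [RHS](congr1 f xE) /= /free_lift !linear_sum.
by apply: eq_bigr => k _; rewrite !linearZ /= hP.
Qed.
End Free.

Definition free_cover (M : lmodType R) : {linear malg M R -> M} :=
  free_lift (id : M -> M).

Lemma free_cover_surj M : surj (free_cover M).
Proof. by move=> x; exists (mkmalgU x 1); apply: free_liftU. Qed.

Fixpoint free_syz (M : lmodType R) (n : nat) : lmodType R :=
  if n is m.+1 then kermod (free_cover (free_syz M m)) else M.

Definition free_diff (M : lmodType R) n
  (x : malg (free_syz M n.+1) R) : malg (free_syz M n) R :=
  val (free_cover (free_syz M n.+1) x).

Lemma free_diff_is_linear M n : linear (@free_diff M n).
Proof. by move=> a x y; rewrite /free_diff linearP. Qed.
HB.instance Definition _ M n :=
  GRing.isLinear.Build R _ _ _ (@free_diff M n) (@free_diff_is_linear M n).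

Lemma free_diff_image M n x :
  free_cover (free_syz M n) x = 0 <-> exists y, @free_diff M n y = x.
Proof.
split=> [x0|[y <-]]; last exact/eqP/(valP (free_cover (free_syz M n.+1) y)).
have xk : x \in ker_pred (free_cover (free_syz M n)) by apply/eqP.
have [y yE] := @free_cover_surj (free_syz M n.+1) (exist _ x xk).
by exists y; rewrite /free_diff yE.
Qed.

Lemma proj_resolution_exists (M : lmodType R) : inhabited (proj_resolution M).
Proof.
constructor.
apply: (@ProjResolution _ M (fun n => malg (free_syz M n) R)
  (free_cover M) (fun n => @free_diff M n)).
- by move=> n; apply: free_projective.
- exact: free_cover_surj.
- exact: (@free_diff_image M 0).
- move=> n x; rewrite -(free_diff_image (n := n.+1)); split.
    by move=> x0; apply: val_inj.
  by move=> x0; rewrite /= /free_diff x0.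
Qed.
End FreeResolution.

Section Rings.
Variable R : nzRingType.

Definition left_ideal (I : {pred R}) : Prop :=
  submod_closed (I : {pred R^o}).

Definition maximal_left_ideal (I : {pred R}) : Prop :=
  [/\ left_ideal I, 1 \notin I &
      forall J : {pred R}, left_ideal J -> 1 \notin J ->
        {subset I <= J} -> {subset J <= I}].

Definition jacobson : {pred R} :=
  [pred x | `[< forall I, maximal_left_ideal I -> x \in I >]].

Definition semisimple_ring : Prop := semisimple_mod (R^o : lmodType R).

Lemma left_idealP (I : {pred R}) : left_ideal I <->
  [/\ 0 \in I, forall x y, x \in I -> y \in I -> x + y \in I &
      forall a x, x \in I -> a * x \in I].
Proof.
split=> [[I0 IL]|[I0 ID IM]]; last first.
  by split=> // a x y xI yI; apply: ID => //; apply: IM.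
have IM a x : x \in I -> a * x \in I.
  by move=> xI; have := IL a x 0 xI I0; rewrite addr0.
by split=> // x y xI yI; have := IL 1 x y xI yI; rewrite scale1r.
Qed.

Lemma jacobsonP x :
  reflect (forall I, maximal_left_ideal I -> x \in I) (x \in jacobson).
Proof. exact: asboolP. Qed.

Lemma jacobson_left_ideal : left_ideal jacobson.
Proof.
apply/left_idealP; split.
- by apply/jacobsonP => I [/left_idealP[]].
- move=> x y /jacobsonP xJ /jacobsonP yJ; apply/jacobsonP => I Imax.
  have [/left_idealP[_ ID _] _ _] := Imax.
  by apply: ID; [apply: xJ|apply: yJ].
- move=> a x /jacobsonP xJ; apply/jacobsonP => I Imax.
  by have [/left_idealP[_ _ IM] _ _] := Imax; apply/IM/xJ.
Qed.

Lemma jacobson_right x b : x \in jacobson -> x * b \in jacobson.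
Proof.
move=> /jacobsonP xJ; apply/jacobsonP => I Imax.
have [/left_idealP[I0 ID IM] I1 Imx] := Imax.
have IN y : y \in I -> - y \in I by move=> /(IM (-1)); rewrite mulN1r.
have [bI|bNI] := boolP (b \in I); first exact: IM.
pose K : {pred R} := [pred y | y * b \in I].
suff: maximal_left_ideal K by apply: xJ.
split.
- apply/left_idealP; split=> [|y z|a y]; rewrite !inE ?mul0r //.
    by rewrite mulrDl; apply: ID.
  by rewrite -mulrA; apply: IM.
- by rewrite inE mul1r.
move=> J /left_idealP[J0 JD JM] J1 KJ y yJ; apply: contraT => yNK.
(* the left ideal I + J b contains I strictly, hence contains 1 *)
pose L : {pred R} := [pred z | `[< exists2 u, u \in I &
  exists2 v, v \in J & z = u + v * b >]].
have Lid : left_ideal L.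
  apply/left_idealP; split=> [|u v|a u].
  - by apply/asboolP; exists 0 => //; exists 0; rewrite // mul0r addr0.
  - move=> /asboolP[u1 u1I [u2 u2J ->]] /asboolP[v1 v1I [v2 v2J ->]].
    apply/asboolP; exists (u1 + v1); first exact: ID.
    by exists (u2 + v2); [apply: JD|rewrite mulrDl addrACA].
  - move=> /asboolP[u1 u1I [u2 u2J ->]].
    apply/asboolP; exists (a * u1); first exact: IM.
    by exists (a * u2); [apply: JM|rewrite mulrDr mulrA].
have IL : {subset I <= L}.
  move=> u uI; apply/asboolP; exists u => //; exists 0 => //.
  by rewrite mul0r addr0.
have yL : y * b \in L.
  by apply/asboolP; exists 0 => //; exists y; rewrite ?add0r.
have L1 : 1 \in L.
  apply: contraT => L1; have := Imx L Lid L1 IL _ yL.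
  by move: yNK; rewrite inE => /negPf->.
case/asboolP: L1 => u uI [v vJ uvE].
(* b = b u + b v b, so (1 - b v) b \in I and 1 - b v \in K <= J *)
have : 1 - b * v \in K.
  rewrite inE mulrBl mul1r -mulrA.
  have -> : v * b = 1 - u by rewrite uvE addrC addKr.
  by rewrite mulrBr mulr1 opprB addrCA subrr addr0; apply: IM.
move=> /KJ bvJ; case/negP: J1.
by rewrite -(subrK (b * v) 1); apply: JD => //; apply: JM.
Qed.
End Rings.
Arguments jacobson R : clear implicits.

Section RadicalQuotient.
Variables (k : fieldType) (A : falgType k).

Lemma left_idealZ (I : {pred A}) : left_ideal I ->
  forall (c : k) x, x \in I -> c *: x \in I.
Proof.
by move=> /left_idealP[_ _ IM] c x xI; rewrite -[x]mul1r scalerAl; apply: IM.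
Qed.

Lemma left_ideal_vspace (I : {pred A}) : left_ideal I ->
  exists U : {vspace A}, forall x, (x \in U) = (x \in I).
Proof.
move=> Iid; have [I0 ID IM] := (left_idealP I).1 Iid.
pose P (d : nat) := `[< exists2 U : {vspace A}, \dim U = d & {subset U <= I} >].
have P0 : exists d, P d.
  exists 0%N; apply/asboolP; exists 0%VS; first exact: dimv0.
  by move=> x; rewrite memv0 => /eqP->.
have Pub d : P d -> (d <= \dim {:A})%N.
  by case/asboolP=> U <- _; apply/dimvS/subvf.
case: (ex_maxnP P0 Pub) => d /asboolP[U dU UI] dmax.
exists U => x; apply/idP/idP => [/UI //|xI].
have UxI : {subset (U + <[x]>)%VS <= I}.
  move=> y /memv_addP[u uU [v /vlineP[c ->] ->]].
  by apply: ID; [apply: UI|apply: left_idealZ].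
have : P (\dim (U + <[x]>)%VS) by apply/asboolP; exists (U + <[x]>)%VS.
move/dmax; rewrite -dU => dle.
have /eqP UE : U == (U + <[x]>)%VS by rewrite eqEdim addvSl.
by rewrite UE; apply: (subvP (addvSr _ _)); apply: memv_line.
Qed.

Definition radv : {vspace A} :=
  sval (cid (left_ideal_vspace (@jacobson_left_ideal A))).

Lemma mem_radv x : (x \in radv) = (x \in jacobson A).
Proof. exact: (svalP (cid (left_ideal_vspace (@jacobson_left_ideal A)))). Qed.

Lemma radv_mull a x : x \in radv -> a * x \in radv.
Proof.
by rewrite !mem_radv; case/left_idealP: (@jacobson_left_ideal A) => _ _; apply.
Qed.

Lemma radv_mulr x b : x \in radv -> x * b \in radv.
Proof. by rewrite !mem_radv; apply: jacobson_right. Qed.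

(** A proper left ideal of maximal dimension is maximal. *)
Lemma radv_1 : 1 \notin radv.
Proof.
pose P (d : nat) := `[< exists I : {pred A}, [/\ left_ideal I, 1 \notin I &
  exists2 U : {vspace A}, \dim U = d & forall x, (x \in U) = (x \in I)] >].
have P0 : exists d, P d.
  exists 0%N; apply/asboolP; exists (fun x : A => x == 0); split.
  - apply/left_idealP; split=> [|x y|a x]; rewrite !unfold_in //.
      by move=> /eqP-> /eqP->; rewrite addr0.
    by move=> /eqP->; rewrite mulr0.
  - by rewrite unfold_in oner_eq0.
  - by exists 0%VS; [apply: dimv0|move=> x; rewrite memv0].
have Pub d : P d -> (d <= \dim {:A})%N.
  by case/asboolP=> I [_ _ [U <- _]]; apply/dimvS/subvf.
case: (ex_maxnP P0 Pub) => d /asboolP[I [Iid I1 [U dU UI]]] dmax.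
rewrite mem_radv; apply/negP => /jacobsonP jac1.
case/negP: (I1); apply: jac1.
split=> // J Jid J1 IJ.
have [V VJ] := left_ideal_vspace Jid.
have : P (\dim V) by apply/asboolP; exists J; split => //; exists V.
move/dmax; rewrite -dU => dle.
have UV : (U <= V)%VS by apply/subvP => x; rewrite UI VJ; apply: IJ.
have /eqP UE : U == V by rewrite eqEdim UV.
by move=> x; rewrite -VJ -UE UI.
Qed.

(** [A / rad A] is carried by a linear complement of [rad A]; the quotient
    map [radquot_pi] is a surjective algebra morphism with kernel [rad A]. *)
Definition radquot := subvs_of (radv^C)%VS.
HB.instance Definition _ := Vector.on radquot.

Definition radquot_pi (x : A) : radquot :=
  vsproj (radv^C)%VS (daddv_pi (radv^C)%VS radv x).

Fact radquot_pi_linear : linear radquot_pi.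
Proof. by move=> c x y; rewrite /radquot_pi !linearP. Qed.
HB.instance Definition _ :=
  GRing.isLinear.Build k A radquot _ radquot_pi radquot_pi_linear.

Definition radquot_repr (x : radquot) : A := vsval x.
Fact radquot_repr_linear : linear radquot_repr. Proof. by []. Qed.
HB.instance Definition _ :=
  GRing.isLinear.Build k radquot A _ radquot_repr radquot_repr_linear.

Let dx : (radv^C :&: radv = 0)%VS.
Proof. by rewrite capvC capv_compl. Qed.

Lemma radquot_reprK : cancel radquot_repr radquot_pi.
Proof.
move=> x; rewrite /radquot_pi daddv_pi_id ?subvsP //; exact: vsvalK.
Qed.

Lemma radquot_pi_surj : surj radquot_pi.
Proof. by move=> x; exists (radquot_repr x); apply: radquot_reprK. Qed.

Lemma radquot_piK x : x - radquot_repr (radquot_pi x) \in radv.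
Proof.
rewrite /radquot_repr /radquot_pi vsprojK ?memv_pi //.
have xf : x \in (radv^C + radv)%VS by rewrite addvC addv_complf memvf.
have -> : x - daddv_pi radv^C radv x = daddv_pi radv radv^C x.
  by apply/eqP; rewrite subr_eq addrC daddv_pi_add.
exact: memv_pi.
Qed.

Lemma radquot_pi_eq0 x : (radquot_pi x == 0) = (x \in radv).
Proof.
have xr := radquot_piK x; apply/eqP/idP => [x0|xJ].
  by move: xr; rewrite x0 (linear0 radquot_repr) subr0.
have : radquot_repr (radquot_pi x) \in (radv^C :&: radv)%VS.
  by rewrite memv_cap subvsP -[radquot_repr _](subKr x) memvB.
rewrite dx memv0 => /eqP r0.
by rewrite -[LHS]radquot_reprK r0 (linear0 radquot_pi).
Qed.

Lemma radquot_eq x y : x - y \in radv -> radquot_pi x = radquot_pi y.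
Proof. by rewrite -radquot_pi_eq0 linearB subr_eq0 => /eqP. Qed.

Definition radquot_mul (x y : radquot) : radquot :=
  radquot_pi (radquot_repr x * radquot_repr y).

Lemma radquot_piM x y :
  radquot_pi (x * y) = radquot_mul (radquot_pi x) (radquot_pi y).
Proof.
apply: radquot_eq; set x' := radquot_repr _; set y' := radquot_repr _.
have -> : x * y - x' * y' = (x - x') * y + x' * (y - y').
  by rewrite mulrBl mulrBr addrA subrK.
by apply: memvD; [apply: radv_mulr | apply: radv_mull]; apply: radquot_piK.
Qed.

Let pi_ind (P : radquot -> Prop) : (forall x, P (radquot_pi x)) -> forall x, P x.
Proof. by move=> Pp x; rewrite -[x]radquot_reprK. Qed.

Fact radquot_mulA : associative radquot_mul.
Proof.
elim/pi_ind=> x; elim/pi_ind=> y; elim/pi_ind=> z.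
by rewrite -!radquot_piM mulrA.
Qed.
Fact radquot_mul1l : left_id (radquot_pi 1) radquot_mul.
Proof. by elim/pi_ind=> x; rewrite -radquot_piM mul1r. Qed.
Fact radquot_mul1r : right_id (radquot_pi 1) radquot_mul.
Proof. by elim/pi_ind=> x; rewrite -radquot_piM mulr1. Qed.
Fact radquot_mulDl : left_distributive radquot_mul +%R.
Proof.
by move=> x y z; rewrite /radquot_mul linearD mulrDl [LHS]linearD.
Qed.
Fact radquot_mulDr : right_distributive radquot_mul +%R.
Proof.
by move=> x y z; rewrite /radquot_mul linearD mulrDr [LHS]linearD.
Qed.
Fact radquot_1_neq0 : radquot_pi 1 != 0.
Proof. by rewrite radquot_pi_eq0 radv_1. Qed.

HB.instance Definition _ := GRing.Zmodule_isNzRing.Build radquot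
  radquot_mulA radquot_mul1l radquot_mul1r radquot_mulDl radquot_mulDr
  radquot_1_neq0.

Fact radquot_scalerAl (c : k) (x y : radquot) : c *: (x * y) = (c *: x) * y.
Proof.
by rewrite /GRing.mul /= /radquot_mul linearZ_LR -scalerAl [RHS]linearZ_LR.
Qed.
HB.instance Definition _ :=
  GRing.Lmodule_isLalgebra.Build k radquot radquot_scalerAl.

Fact radquot_scalerAr (c : k) (x y : radquot) : c *: (x * y) = x * (c *: y).
Proof.
by rewrite /GRing.mul /= /radquot_mul linearZ_LR -scalerAr [RHS]linearZ_LR.
Qed.
HB.instance Definition _ :=
  GRing.Lalgebra_isAlgebra.Build k radquot radquot_scalerAr.
HB.instance Definition _ := Algebra_isFalgebra.Build k radquot.

Fact radquot_pi_monoid : monoid_morphism radquot_pi.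
Proof. by split=> // x y; apply: radquot_piM. Qed.
HB.instance Definition _ :=
  GRing.isMonoidMorphism.Build A radquot radquot_pi radquot_pi_monoid.
End RadicalQuotient.

(** The opposite algebra is carried by the converse ring [A^c]. *)
Section Opposite.
Variables (k : fieldType) (A : falgType k).

HB.instance Definition _ := GRing.Lmodule.copy A^c A.
HB.instance Definition _ := Vector.copy A^c A.

Lemma conv_scalerAl (c : k) (x y : A^c) :
  c *: (x * y) = @GRing.mul A^c (c *: x) y.
Proof. exact: (@scalerAr k A c y x). Qed.
HB.instance Definition _ :=
  GRing.Lmodule_isLalgebra.Build k A^c conv_scalerAl.

Lemma conv_scalerAr (c : k) (x y : A^c) : c *: (x * y) = x * (c *: y).
Proof. exact: (@scalerAl k A c y x). Qed.
HB.instance Definition _ := GRing.Lalgebra_isAlgebra.Build k A^c conv_scalerAr.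
End Opposite.

(** [A (x) B] is realised as the space of coordinate matrices relative to the
    basis [e_i (x) f_j], where [e] and [f] are bases of [A] and [B]; then
    [a (x) b] is [ptens a b], and the product is determined by [ptensM]. *)
Section Tensor.
Variables (k : fieldType) (A B : falgType k).

Local Notation m := (\dim {:A}).
Local Notation n := (\dim {:B}).
Local Notation e i := ((vbasis {:A})`_(i : nat)).
Local Notation f j := ((vbasis {:B})`_(j : nat)).

Definition tens := 'M[k]_(m, n).
HB.instance Definition _ := Vector.on tens.

Definition ptens (a : A) (b : B) : tens :=
  \matrix_(i, j) (coord (vbasis {:A}) i a * coord (vbasis {:B}) j b).

Definition tens_mul (x y : tens) : tens :=
  \sum_i \sum_j \sum_i' \sum_j'
    (x i j * y i' j') *: ptens (e i * e i') (f j * f j').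

Let ptensl b a := ptens a b.

Fact ptens_linl b : linear (ptensl b).
Proof.
by move=> c x y; apply/matrixP=> i j; rewrite !mxE linearP mulrDl mulrA.
Qed.

Fact ptens_linr a : linear (ptens a).
Proof.
move=> c x y; apply/matrixP=> i j; rewrite !mxE linearP mulrDr.
by rewrite mulrCA.
Qed.

HB.instance Definition _ b :=
  GRing.isLinear.Build k A tens _ (ptensl b) (ptens_linl b).
HB.instance Definition _ a :=
  GRing.isLinear.Build k B tens _ (ptens a) (ptens_linr a).

Lemma ptens_suml (I : Type) (r : seq I) (P : pred I) (F : I -> A) b :
  ptens (\sum_(i <- r | P i) F i) b = \sum_(i <- r | P i) ptens (F i) b.
Proof. exact: (linear_sum (ptensl b)). Qed.
Lemma ptens_sumr (I : Type) (r : seq I) (P : pred I) (F : I -> B) a :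
  ptens a (\sum_(i <- r | P i) F i) = \sum_(i <- r | P i) ptens a (F i).
Proof. exact: (linear_sum (ptens a)). Qed.
Lemma ptensZl c a b : ptens (c *: a) b = c *: ptens a b.
Proof. exact: (linearZ_LR (ptensl b)). Qed.
Lemma ptensZr c a b : ptens a (c *: b) = c *: ptens a b.
Proof. exact: (linearZ_LR (ptens a)). Qed.

Lemma tens_ptens (x : tens) :
  x = \sum_i \sum_j x i j *: ptens (e i) (f j).
Proof.
rewrite [LHS]matrix_sum_delta; apply: eq_bigr => i _; apply: eq_bigr => j _.
congr (_ *: _); apply/matrixP=> i' j'; rewrite !mxE.
rewrite !coord_free ?(basis_free (vbasisP _)) //.
by rewrite -natrM mulnb eq_sym (eq_sym j').
Qed.

Lemma tens_ind (P : tens -> Prop) :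
  (forall x y, P x -> P y -> P (x + y)) -> (forall a b, P (ptens a b)) ->
  forall x, P x.
Proof.
move=> PD Pp x; have P0 : P 0 by rewrite -(linear0 (ptens 0)); apply: Pp.
rewrite [x]tens_ptens; apply: big_ind => // i _; apply: big_ind => // j _.
by rewrite -ptensZl.
Qed.

Let tens_mull y x := tens_mul x y.

Fact tens_mul_linl y : linear (tens_mull y).
Proof.
move=> c x x'; rewrite /tens_mull /tens_mul.
do 4![rewrite ?scaler_sumr -?big_split; apply: eq_bigr => ? _ /=].
by rewrite !mxE scalerA -scalerDl mulrDl mulrA.
Qed.

Fact tens_mul_linr x : linear (tens_mul x).
Proof.
move=> c y y'; rewrite /tens_mul.
do 4![rewrite ?scaler_sumr -?big_split; apply: eq_bigr => ? _ /=].
by rewrite !mxE scalerA -scalerDl mulrDr mulrCA.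
Qed.

HB.instance Definition _ y :=
  GRing.isLinear.Build k tens tens _ (tens_mull y) (tens_mul_linl y).
HB.instance Definition _ x :=
  GRing.isLinear.Build k tens tens _ (tens_mul x) (tens_mul_linr x).

Lemma tens_mulDl : left_distributive tens_mul +%R.
Proof. by move=> x y z; apply: (linearD (tens_mull z)). Qed.
Lemma tens_mulDr : right_distributive tens_mul +%R.
Proof. by move=> x y z; apply: (linearD (tens_mul x)). Qed.

Lemma tens_mul_ptens a b a' b' :
  tens_mul (ptens a b) (ptens a' b') = ptens (a * a') (b * b').
Proof.
rewrite [in RHS](coord_vbasis (memvf a)) [in RHS](coord_vbasis (memvf a')).
rewrite [in RHS](coord_vbasis (memvf b)) [in RHS](coord_vbasis (memvf b')).
rewrite mulr_suml ptens_suml; apply: eq_bigr => i _.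
rewrite mulr_suml ptens_sumr; apply: eq_bigr => j _.
rewrite mulr_sumr ptens_suml; apply: eq_bigr => i' _.
rewrite mulr_sumr ptens_sumr; apply: eq_bigr => j' _.
rewrite !mxE -!scalerAl -!scalerAr !ptensZl !ptensZr !scalerA.
by congr (_ *: _); rewrite mulrACA mulrA.
Qed.

Lemma tens_mulA : associative tens_mul.
Proof.
move=> x y z.
elim/tens_ind: x => [x x' Hx Hx'|a b]; first by rewrite !tens_mulDl Hx Hx'.
elim/tens_ind: y => [y y' Hy Hy'|a' b'].
  by rewrite !(tens_mulDl, tens_mulDr) Hy Hy'.
elim/tens_ind: z => [z z' Hz Hz'|a'' b''].
  by rewrite !tens_mulDr Hz Hz'.
by rewrite !tens_mul_ptens !mulrA.
Qed.

Lemma tens_mul1l : left_id (ptens 1 1) tens_mul.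
Proof.
elim/tens_ind=> [x x' Hx Hx'|a b]; first by rewrite tens_mulDr Hx Hx'.
by rewrite tens_mul_ptens !mul1r.
Qed.

Lemma tens_mul1r : right_id (ptens 1 1) tens_mul.
Proof.
elim/tens_ind=> [x x' Hx Hx'|a b]; first by rewrite tens_mulDl Hx Hx'.
by rewrite tens_mul_ptens !mulr1.
Qed.

Lemma tens_oner_neq0 : ptens 1 1 != 0.
Proof.
apply/eqP=> /matrixP t0.
have coord_neq0 (C : falgType k) :
    exists i, coord (vbasis {:C}) i 1 != 0.
  apply/existsP; apply: contraT; rewrite negb_exists => /forallP c0.
  have := oner_neq0 C; rewrite (coord_vbasis (memvf (1 : C))) big1 ?eqxx //.
  by move=> i _; move/negbNE/eqP: (c0 i) => ->; rewrite scale0r.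
have [i ci] := coord_neq0 A; have [j cj] := coord_neq0 B.
by move/eqP: (t0 i j); rewrite !mxE mulf_eq0 (negPf ci) (negPf cj).
Qed.

HB.instance Definition _ := GRing.Zmodule_isNzRing.Build tens
  tens_mulA tens_mul1l tens_mul1r tens_mulDl tens_mulDr tens_oner_neq0.

Lemma ptensM a b a' b' : ptens a b * ptens a' b' = ptens (a * a') (b * b').
Proof. exact: tens_mul_ptens. Qed.

Lemma tens_scalerAl (c : k) (x y : tens) : c *: (x * y) = (c *: x) * y.
Proof. exact: esym (linearZ_LR (tens_mull y) c _). Qed.
HB.instance Definition _ := GRing.Lmodule_isLalgebra.Build k tens tens_scalerAl.

Lemma tens_scalerAr (c : k) (x y : tens) : c *: (x * y) = x * (c *: y).
Proof. exact: esym (linearZ_LR (tens_mul x) c _). Qed.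
HB.instance Definition _ :=
  GRing.Lalgebra_isAlgebra.Build k tens tens_scalerAr.
HB.instance Definition _ := Algebra_isFalgebra.Build k tens.
End Tensor.

Section Enveloping.
Variables (k : fieldType) (A : falgType k).

Definition enveloping : falgType k := tens A A^c.

(** [A] as a left module over [enveloping A], with [(a (x) b) x = a x b]. *)
Definition bimod := (A : Type).
HB.instance Definition _ := GRing.Zmodule.on bimod.

Definition bimod_act (t : enveloping) (x : bimod) : bimod :=
  \sum_i \sum_j
    t i j *: ((vbasis {:A})`_i * (x : A) * (vbasis {:A^c})`_j : A).

Lemma bimod_actDr : right_distributive bimod_act +%R.
Proof.
move=> t x y; rewrite /bimod_act.
do 2![rewrite -?big_split; apply: eq_bigr => ? _ /=].
by rewrite mulrDr mulrDl scalerDr.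
Qed.

Lemma bimod_actDl x : {morph bimod_act^~ x : s t / s + t}.
Proof.
move=> s t; rewrite /bimod_act.
do 2![rewrite -?big_split; apply: eq_bigr => ? _ /=].
by rewrite mxE scalerDl.
Qed.

Lemma bimod_act_ptens (a : A) (b : A^c) x :
  bimod_act (ptens a b) x = (a : A) * (x : A) * (b : A).
Proof.
rewrite [in RHS](coord_vbasis (memvf a)) [in RHS](coord_vbasis (memvf b)).
rewrite !mulr_suml; apply: eq_bigr => i _.
rewrite mulr_sumr; apply: eq_bigr => j _.
rewrite mxE -scalerA -!scalerAl; congr (_ *: _).
exact: (@scalerAr k A).
Qed.

Lemma bimod_actA s t x : bimod_act s (bimod_act t x) = bimod_act (s * t) x.
Proof.
elim/tens_ind: s => [s s' Hs Hs'|a b].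
  by rewrite mulrDl !bimod_actDl Hs Hs'.
elim/tens_ind: t => [t t' Ht Ht'|a' b'].
  by rewrite mulrDr !bimod_actDl bimod_actDr Ht Ht'.
by rewrite ptensM !bimod_act_ptens !mulrA.
Qed.

Lemma bimod_act1 : left_id 1 bimod_act.
Proof. by move=> x; rewrite [LHS]bimod_act_ptens mul1r; apply: mulr1. Qed.

HB.instance Definition _ := GRing.Zmodule_isLmodule.Build enveloping bimod
  bimod_actA bimod_act1 bimod_actDr bimod_actDl.

Lemma ptens_bimodE (a : A) (b : A^c) (x : bimod) :
  (ptens a b : enveloping) *: x = ((a : A) * (x : A) * (b : A) : A).
Proof. exact: bimod_act_ptens. Qed.

(** The bimodule structure on [Hom_k(A, k)] is [(a g b)(y) = g (b y a)]. *)
Definition symmetric_alg : Prop :=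
  exists2 phi : {linear A -> 'Hom(A, k^o)}, bijective phi &
    forall a x b y : A, phi (a * x * b) y = phi x (b * y * a).

Definition periodic_alg : Prop :=
  exists2 p : nat, (0 < p)%N &
  exists2 P : proj_resolution (bimod : lmodType enveloping),
    minimal_resolution P & mod_iso (bimod : lmodType enveloping) (syzygy P p).
End Enveloping.

(* Main.v *)
Require Import Defs.
From HB Require Import structures.
From mathcomp Require Import all_boot all_order all_algebra.
From mathcomp Require Import falgebra.
From mathcomp Require Import boolp.
Set Implicit Arguments.
Unset Strict Implicit.
Unset Printing Implicit Defensive.
Import GRing.Theory.
Local Open Scope ring_scope.

(** A symmetrizing form with dual bases [e], [e'] turns every k-linear map [h]
    between [A]-modules into the [A]-linear map [avg h = sum_i e_i h(e'_i -)].
    An [A]-linear map is stably zero iff it is such an average, and a module is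
    relatively projective if its identity is one.  If [B_n] are the syzygies of
    the bimodule [A], the modules [Hom_A(B_n, N)] are successive cosyzygies of
    [N], so a periodic [A] makes every [N] a cosyzygy of itself of arbitrarily
    large order.  Dimension shifting then rewrites [Ext^n(M, N) = 0] for one
    suitable large [n] as: every map [M -> C] is an average, for a prescribed
    cosyzygy [C] of [N].  Since [avg] is self-adjoint for the trace pairing of
    [Hom_k(M, C)] with [Hom_k(C, M)], Tate duality gives the same for maps
    [C' -> M], [C'] the next cosyzygy, and shifting back along a period of [N]
    yields [Ext^m(N, M) = 0] for any given [m > 0]. *)

(** * Linear bijections and linear combinations *)

Lemma linear_inverse (R : pzRingType) (U V : lmodType R) (f : {linear U -> V}) :
  bijective f -> exists g : {linear V -> U}, cancel f g /\ cancel g f.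
Proof.
move=> [g fK gK].
have gl : linear g by move=> a x y; apply: (can_inj fK); rewrite linearP !gK.
pose G := GRing.isLinear.Build R V U _ g gl.
by exists (HB.pack g G : {linear V -> U}).
Qed.

Section RowCombination.
Variable R : pzRingType.
Implicit Types U V : lmodType R.

Definition row_comb V n (v : 'I_n -> V) (x : 'rV[R]_n) : V :=
  \sum_i x 0 i *: v i.

Fact row_comb_linear V n (v : 'I_n -> V) : linear (row_comb v).
Proof.
move=> a x y; rewrite /row_comb scaler_sumr -big_split.
by apply: eq_bigr => i _; rewrite !mxE scalerDl scalerA.
Qed.
HB.instance Definition _ V n (v : 'I_n -> V) :=
  GRing.isLinear.Build R 'rV[R]_n V _ (row_comb v) (row_comb_linear v).

Lemma linear_rowE n V (f : {linear 'rV[R]_n -> V}) x :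
  f x = \sum_i x 0 i *: f (delta_mx 0 i).
Proof.
rewrite {1}[x]row_sum_delta linear_sum.
by apply: eq_bigr => i _; rewrite linearZ.
Qed.

Lemma injective_linear0 U V (f : {linear U -> V}) :
  (forall x, f x = 0 -> x = 0) -> injective f.
Proof.
move=> f0 x y fxy; apply/eqP; rewrite -subr_eq0; apply/eqP/f0.
by rewrite linearB fxy subrr.
Qed.
End RowCombination.

(** * Finite dimensional vector spaces *)

Section FiniteDimension.
Variable k : fieldType.
Implicit Types U V W : lmodType k.

Definition fdim V : Prop := exists n, mod_iso V 'rV[k]_n.

Lemma injective_row_leq m n (f : {linear 'rV[k]_m -> 'rV[k]_n}) :
  injective f -> (m <= n)%N.
Proof.
move=> finj; have : row_free (lin1_mx f).
  apply/inj_row_free => v; rewrite mul_rV_lin1 => fv0.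
  by apply: finj; rewrite linear0.
by rewrite /row_free => /eqP <-; apply: rank_leq_col.
Qed.

(** An injective map from a row space of maximal dimension is onto: a vector outside its image would
    extend it injectively by one more coordinate. *)
Lemma fdim_bounded V n :
  (forall m (f : {linear 'rV[k]_m -> V}), injective f -> (m <= n)%N) -> fdim V.
Proof.
move=> bound.
pose P m := `[< exists f : {linear 'rV[k]_m -> V}, injective f >].
have P0 : exists m, P m.
  exists 0%N; apply/asboolP; exists (row_comb (fun _ => 0)).
  by apply: injective_linear0 => x _; apply/rowP; case.
have Pub m : P m -> (m <= n)%N by case/asboolP => f; apply: bound.
case: (ex_maxnP P0 Pub) => m /asboolP[f finj] mmax.
have fsurj y : exists x, f x = y.
  apply: contrapT => /forallNP yNf.
  suff : P m.+1 by move/mmax; rewrite ltnn.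
  apply/asboolP.
  exists (row_comb (fun i =>
    if unlift ord0 i is Some j then f (delta_mx 0 j) else y)).
  apply: injective_linear0 => x.
  rewrite /= /row_comb big_ord_recl unlift_none.
  pose x' : 'rV[k]_m := \row_j x 0 (lift ord0 j).
  have -> : \sum_(i < m) x 0 (lift ord0 i) *:
     (if unlift ord0 (lift ord0 i) is Some j then f (delta_mx 0 j) else y) =
     f x'.
    by rewrite linear_rowE; apply: eq_bigr => i _; rewrite liftK mxE.
  have [x0|x0] := eqVneq (x 0 ord0) 0.
    rewrite x0 scale0r add0r -[RHS](linear0 f) => /finj x'0.
    apply/rowP => i; rewrite mxE; case: (unliftP ord0 i) => [j ->|-> //].
    by move/rowP/(_ j): x'0; rewrite !mxE.
  move=> /eqP; rewrite addr_eq0 => /eqP yE.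
  case: (yNf (- (x 0 ord0)^-1 *: x')).
  by rewrite linearZ /= scaleNr -scalerN -yE scalerA mulVf // scale1r.
have [g gP] := choice fsurj.
have fK : cancel f g by move=> x; apply/finj/gP.
have [h [hK Kh]] := linear_inverse (Bijective fK gP).
by exists m, h; exists f.
Qed.

Lemma fdim_lift U V W (g : {linear U -> V}) (f : {linear W -> V}) :
  fdim W -> surj g -> exists h : {linear W -> U}, forall x, g (h x) = f x.
Proof.
move=> [n [b /linear_inverse[b' [bK b'K]]]] gsurj.
have [u uP] := choice (fun i => gsurj (f (b' (delta_mx 0 i)))).
exists (row_comb u \o b) => x /=.
rewrite /row_comb linear_sum -[in RHS](bK x) linear_rowE linear_sum.
by apply: eq_bigr => i _; rewrite !linearZ /= uP.
Qed.

Lemma fdim_sub U V (f : {linear U -> V}) : injective f -> fdim V -> fdim U.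
Proof.
move=> finj [n [b [b' bK b'K]]]; apply: (@fdim_bounded _ n) => m g ginj.
apply: (@injective_row_leq _ _ (b \o (f \o g))) => x y /=.
by move/(can_inj bK)/finj/ginj.
Qed.

Lemma fdim_row n : fdim 'rV[k]_n.
Proof. by exists n, idfun; exists id. Qed.

Lemma fdim_quot U V (f : {linear U -> V}) : surj f -> fdim U -> fdim V.
Proof.
move=> fsurj [n [b [b' bK b'K]]]; apply: (@fdim_bounded _ n) => m g ginj.
have [h hP] := fdim_lift g (fdim_row m) fsurj.
apply: (@injective_row_leq _ _ (b \o h)) => x y /= /(can_inj bK) hxy.
by apply: ginj; rewrite -!hP hxy.
Qed.

Lemma fdim_span V (T : finType) (v : T -> V) :
  (forall x, exists c : T -> k, x = \sum_t c t *: v t) -> fdim V.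
Proof.
move=> vspan; apply: (@fdim_quot _ _ (row_comb (fun i : 'I_#|T| => v (enum_val i))));
  last first.
  exact: fdim_row.
move=> x; have [c ->] := vspan x.
exists (\row_i c (enum_val i)); rewrite /= /row_comb.
rewrite [RHS](reindex _ (onW_bij _ (@enum_val_bij T))).
by apply: eq_bigr => i _; rewrite mxE.
Qed.

(** In coordinates [f] is a row-free matrix, whose pseudo-inverse supplies [r]. Such retractions
    extend k-linear maps from a submodule before averaging. *)
Lemma fdim_retract U V (f : {linear U -> V}) : fdim V -> injective f ->
  exists r : {linear V -> U}, forall x, r (f x) = x.
Proof.
move=> Vfd finj; have [n [b [b' bK b'K]]] := Vfd.
have [m [c /linear_inverse[c' [cK c'K]]]] := fdim_sub finj Vfd.
pose F := lin1_mx (b \o (f \o c')).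
have Ffree : row_free F.
  apply/inj_row_free => v; rewrite mul_rV_lin1 /= => h.
  apply: (can_inj c'K); apply: finj; apply: (can_inj bK).
  by rewrite h !linear0.
exists (c' \o (mulmxr (pinvmx F) \o b)) => x /=.
have -> : b (f x) = c x *m F by rewrite mul_rV_lin1 /= cK.
by rewrite -mulmxA mulmxVp // mulmx1 cK.
Qed.

Lemma fdim_mx m n : fdim 'M[k]_(m, n).
Proof.
by exists (m * n)%N, mxvec; exists vec_mx; [apply: mxvecK|apply: vec_mxK].
Qed.

Lemma mxtrace_eq0 m n (M : 'M[k]_(m, n)) :
  (forall Y : 'M_(n, m), \tr (Y *m M) = 0) -> M = 0.
Proof.
move=> M0; apply/matrixP => i j; rewrite mxE -[RHS](M0 (delta_mx j i)).
rewrite /mxtrace (bigD1 j) //= big1 => [|l /negPf lj]; last first.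
  by rewrite mxE big1 // => l' _; rewrite mxE lj mul0r.
rewrite addr0 mxE (bigD1 i) //= big1 => [|l /negPf li].
  by rewrite mxE !eqxx mul1r addr0.
by rewrite mxE li andbF mul0r.
Qed.

Lemma mxtrace_represents m n (l : {linear 'M[k]_(n, m) -> k^o}) :
  exists F : 'M_(m, n), forall Y, l Y = \tr (Y *m F).
Proof.
exists (\matrix_(j, i) l (delta_mx i j)) => Y.
rewrite [Y in LHS]matrix_sum_delta linear_sum; apply: eq_bigr => i _.
rewrite linear_sum mxE; apply: eq_bigr => j _.
by rewrite linearZ mxE.
Qed.

(** Double orthogonality for the trace pairing: the columns of [cokermx W] are functionals cutting
    out the sum [W] of the images, and each functional is the pairing with some matrix [F]. *)
Lemma mxtrace_separation m n d
    (T : 'I_d -> {linear 'M[k]_(n, m) -> 'M[k]_(n, m)}) G :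
  (forall F : 'M_(m, n),
    (forall j Y, \tr (T j Y *m F) = 0) -> \tr (G *m F) = 0) ->
  exists Ys, G = \sum_j T j (Ys j).
Proof.
move=> GT; pose W := (\sum_j lin_mx (T j))%MS.
have : (mxvec G <= W)%MS.
  rewrite submxE; apply/eqP/rowP => c; rewrite [RHS]mxE.
  pose l Y : k^o := (mxvec Y *m cokermx W) 0 c.
  have ll : linear l by move=> a x y; rewrite /l linearP mulmxDl -scalemxAl !mxE.
  pose L := GRing.isLinear.Build k 'M[k]_(n, m) k^o _ l ll.
  have [F FP] := mxtrace_represents (HB.pack l L : {linear 'M[k]_(n, m) -> k^o}).
  rewrite -[LHS]/(l G) [LHS]FP; apply: GT => j Y; rewrite -FP /= /l -mul_vec_lin.
  have : (mxvec Y *m lin_mx (T j) <= W)%MS.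
    by rewrite (submx_trans (submxMl _ _)) // (sumsmx_sup j).
  by rewrite submxE => /eqP->; rewrite mxE.
move=> /sub_sumsmxP[u uP]; exists (fun j => vec_mx (u j)).
apply: (can_inj mxvecK); rewrite uP linear_sum; apply: eq_bigr => j _ /=.
by rewrite -mul_vec_lin vec_mxK.
Qed.

Lemma linear_bigsum U V (I : finType) (F : I -> {linear U -> V}) :
  exists f : {linear U -> V}, forall x, f x = \sum_i F i x.
Proof.
have fl : linear (fun x => \sum_i F i x).
  move=> a x y; rewrite scaler_sumr -big_split.
  by apply: eq_bigr => i _; rewrite linearP.
pose L := GRing.isLinear.Build k U V _ _ fl.
by exists (HB.pack (fun x => \sum_i F i x) L : {linear U -> V}).
Qed.
End FiniteDimension.

(** * Exact sequences and resolutions *)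

Section Factorization.
Variable R : pzRingType.
Implicit Types U V W : lmodType R.

Lemma factor_mono U V W (i : {linear U -> V}) (f : {linear W -> V}) :
  injective i -> (forall x, exists y, i y = f x) ->
  exists g : {linear W -> U}, forall x, i (g x) = f x.
Proof.
move=> iinj /choice[g gP].
have gl : linear g by move=> a x y; apply: iinj; rewrite linearP !gP linearP.
pose G := GRing.isLinear.Build R W U _ g gl.
by exists (HB.pack g G : {linear W -> U}).
Qed.

Lemma factor_epi U V W (p : {linear V -> U}) (f : {linear V -> W}) :
  surj p -> (forall x, p x = 0 -> f x = 0) ->
  exists g : {linear U -> W}, forall x, g (p x) = f x.
Proof.
move=> /choice[s sK] f0.
have fE x y : p x = p y -> f x = f y.
  move=> pxy; apply/eqP; rewrite -subr_eq0 -linearB; apply/eqP/f0.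
  by rewrite linearB pxy subrr.
have gl : linear (f \o s).
  by move=> a x y /=; rewrite -linearP; apply: fE; rewrite linearP !sK.
pose G := GRing.isLinear.Build R U W _ (f \o s) gl.
by exists (HB.pack (f \o s) G : {linear U -> W}) => x; apply: fE; rewrite sK.
Qed.

Lemma kermod_inclusion U V (f : {linear U -> V}) :
  exists inc : {linear kermod f -> U},
    [/\ inc =1 val, injective inc, forall x, f (inc x) = 0 &
        forall x, f x = 0 -> exists y, inc y = x].
Proof.
exists (val : {linear kermod f -> U}); split=> // [|x|x /eqP x0].
- exact: val_inj.
- exact/eqP/(valP x).
- by exists (exist _ x x0).
Qed.

Lemma kermod_cover U V W (d : {linear U -> V}) (d' : {linear V -> W}) :
  (forall x, d' x = 0 <-> exists y, d y = x) ->
  exists q : {linear U -> kermod d'}, surj q /\ forall x, q x = 0 <-> d x = 0.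
Proof.
move=> exact; have [inc [_ incinj inc0 inck]] := kermod_inclusion d'.
have [|q qP] := factor_mono (f := d) incinj.
  by move=> x; apply/inck/exact; exists x.
exists q; split=> [y|x]; last first.
  rewrite -qP; split=> [->|/eqP]; rewrite ?linear0 //.
  by rewrite -(linear0 inc) => /eqP/incinj.
have /exact[x xy] := inc0 y.
by exists x; apply: incinj; rewrite qP.
Qed.

Lemma syzygy_sequence M (P : proj_resolution M) n :
  exists (q : {linear P n -> syzygy P n}) (j : {linear syzygy P n.+1 -> P n}),
    [/\ surj q, injective j, forall x, q x = 0 <-> exists y, j y = x &
      minimal_resolution P -> @superfluous R _ (ker_pred q)].
Proof.
case: n => [|n].
  have [inc [_ incinj inc0 inck]] := kermod_inclusion (res_aug P).
  exists (res_aug P), inc; split=> //; first exact: res_aug_surj.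
    by move=> x; split=> [/inck|[y <-]].
  by case.
have [inc [_ incinj inc0 inck]] := kermod_inclusion (res_diff P n).
have [q [qsurj q0]] : exists q : {linear P n.+1 -> syzygy P n.+1},
    surj q /\ forall x, q x = 0 <-> res_diff P n x = 0.
  case: n {inc incinj inc0 inck} => [|n].
    exact: kermod_cover (@res_exact0 _ _ P).
  exact: kermod_cover (@res_exactS _ _ P n).
exists q, inc; split=> // [x|[_ /(_ n) sup] T Tsub qT].
  by rewrite q0; split=> [/inck|[y <-]].
apply: sup Tsub _ => x; have [s /eqP/q0/eqP s0 [t tT ->]] := qT x.
by exists s => //; exists t.
Qed.

Lemma projective_dual_basis P : projective P -> fin_gen P ->
  exists n (g : 'I_n -> P) (s : {linear P -> 'rV[R]_n}),
    forall x, x = \sum_l s x 0 l *: g l.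
Proof.
move=> Pproj [n [g gP]].
have gsurj : surj (row_comb g).
  move=> x; have [c ->] := gP x; exists (\row_i c i).
  by apply: eq_bigr => i _; rewrite mxE.
have [s sP] := Pproj _ _ (row_comb g) idfun gsurj.
by exists n, g, s => x; rewrite -[LHS]sP.
Qed.

Lemma projective_retract (P U : lmodType R) (j : {linear U -> P}) (r : {linear P -> U}) :
  cancel j r -> projective P -> projective U.
Proof.
move=> jK Pproj W V g f gsurj.
have [h hP] := Pproj _ _ g (f \o r) gsurj.
by exists (h \o j) => x; rewrite /= hP /= jK.
Qed.

(** Lifts of generators of [V] span a submodule [T] which together with the kernel gives [U], so [T]
    is all of [U]. *)
Lemma superfluous_fin_gen U V (q : {linear U -> V}) :
  surj q -> @superfluous R _ (ker_pred q) -> fin_gen V -> fin_gen U.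
Proof.
move=> /choice[s sK] sup [n [g gP]]; exists n, (s \o g) => x.
pose T : {pred U} := [pred x | `[< exists c, x = \sum_i c i *: s (g i) >]].
apply/(asboolP (exists c : 'I_n -> R, x = \sum_i c i *: s (g i))).
apply: (sup T) => [|y].
  split=> [|a y z /asboolP[c ->] /asboolP[d ->]]; apply/asboolP.
    by exists (fun=> 0); rewrite big1 // => i _; rewrite scale0r.
  exists (fun i => a * c i + d i); rewrite scaler_sumr -big_split.
  by apply: eq_bigr => i _; rewrite scalerDl scalerA.
have [c cP] := gP (q y).
exists (y - \sum_i c i *: s (g i)); last first.
  exists (\sum_i c i *: s (g i)); last by rewrite subrK.
  by apply/asboolP; exists c.
rewrite inE linearB linear_sum cP subr_eq0; apply/eqP/eq_bigr => i _.
by rewrite linearZ /= sK.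
Qed.
End Factorization.

(** * Averages over dual bases *)

Section Restriction.
Variables (k : fieldType) (A : falgType k).
Implicit Types U V W : lmodType A.

(** An alias of the carrier, so that the [A]-module and its underlying [k]-space coexist as distinct
    structures. *)
Definition restr V : Type := V.
HB.instance Definition _ V := GRing.Zmodule.on (restr V).

Definition restr_scale V (c : k) (x : restr V) : restr V :=
  c%:A *: (x : V).

Section Laws.
Variable V : lmodType A.
Fact restr_scaleA c d (x : restr V) :
  restr_scale c (restr_scale d x) = restr_scale (c * d) x.
Proof. by rewrite /restr_scale scalerA mulr_algl scalerA. Qed.
Fact restr_scale1 : left_id 1 (@restr_scale V).
Proof. by move=> x; rewrite /restr_scale scale1r [LHS]scale1r. Qed.
Fact restr_scaleDr : right_distributive (@restr_scale V) +%R.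
Proof. by move=> c x y; apply: scalerDr. Qed.
Fact restr_scaleDl (x : restr V) : {morph (@restr_scale V)^~ x : c d / c + d}.
Proof. by move=> c d; rewrite /restr_scale scalerDl [LHS]scalerDl. Qed.
HB.instance Definition _ := GRing.Zmodule_isLmodule.Build k (restr V)
  restr_scaleA restr_scale1 restr_scaleDr restr_scaleDl.
End Laws.

Lemma restrZE V (c : k) (x : V) : c *: (x : restr V) = c%:A *: x.
Proof. by []. Qed.

Lemma restrZl V (c : k) (a : A) (x : V) : (c *: a) *: x = c *: (a *: x : restr V).
Proof. by rewrite restrZE scalerA mulr_algl. Qed.

Lemma restrZr V (c : k) (a : A) (x : V) :
  a *: (c *: (x : restr V) : V) = (c *: a) *: x.
Proof. by rewrite restrZE scalerA mulr_algr. Qed.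

Definition restr_map U V (f : U -> V) : restr U -> restr V := f.

Fact restr_map_linear U V (f : {linear U -> V}) : linear (restr_map f).
Proof. by move=> c x y; rewrite /restr_map linearP. Qed.
HB.instance Definition _ U V (f : {linear U -> V}) :=
  GRing.isLinear.Build k (restr U) (restr V) _ (restr_map f) (restr_map_linear f).

Definition restr_act V (a : A) (x : restr V) : restr V := a *: (x : V).
Fact restr_act_linear V a : linear (@restr_act V a).
Proof. by move=> c x y; rewrite /restr_act scalerDr restrZr restrZl. Qed.
HB.instance Definition _ V a :=
  GRing.isLinear.Build k (restr V) (restr V) _ (@restr_act V a)
    (@restr_act_linear V a).

Lemma fin_gen_fdim V : fin_gen V -> fdim (restr V).
Proof.
move=> [n [g gP]].
apply: (@fdim_span k (restr V) ('I_n * 'I_(\dim {:A}))%type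
  (fun ij => (vbasis {:A})`_(ij.2) *: g ij.1)) => x.
have [c ->] := gP x.
exists (fun ij => coord (vbasis {:A}) ij.2 (c ij.1)).
rewrite -(pair_bigA _ (fun i j => coord (vbasis {:A}) j (c i) *:
  ((vbasis {:A})`_j *: g i : restr V))) /=.
apply: eq_bigr => i _; rewrite {1}(coord_vbasis (memvf (c i))) scaler_suml.
by apply: eq_bigr => j _; rewrite restrZl.
Qed.

Lemma fdim_fin_gen V : fdim (restr V) -> fin_gen V.
Proof.
move=> [n [b /linear_inverse[b' [bK _]]]].
exists n, (fun i => b' (delta_mx 0 i)) => x; exists (fun i => (b x 0 i)%:A).
by rewrite -[LHS]bK linear_rowE.
Qed.
End Restriction.
Arguments restr_act {k A} V a.

(** * Dual bases of a symmetric algebra *)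

Section SymmetricForm.
Variables (k : fieldType) (A : falgType k).

Definition dual_bases (lam : A -> k) (e e' : 'I_(\dim {:A}) -> A) : Prop :=
  [/\ forall x y, lam (x * y) = lam (y * x),
      forall y, y = \sum_i lam (y * e' i) *: e i &
      forall y, y = \sum_i lam (y * e i) *: e' i].

(** The form is [phi 1]. Bimodule linearity makes [phi a y] equal to both [lam (y * a)] and
    [lam (a * y)], whence the trace property; the [e' i] are the preimages of the coordinate
    functionals. *)
Lemma symmetric_dual_bases : symmetric_alg A ->
  exists (lam : {linear A -> k^o}) e e', dual_bases lam e e'.
Proof.
move=> [phi [psi phiK psiK] phiP].
pose lam : {linear A -> k^o} := phi 1.
have phil a y : phi a y = lam (y * a).
  by rewrite -[a in LHS]mulr1 -[a * 1]mulr1 phiP mul1r.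
have phir a y : phi a y = lam (a * y).
  by rewrite -[a in LHS]mul1r -[1 * a]mul1r mulrA phiP mulr1.
pose e i := (vbasis {:A})`_(i : 'I_(\dim {:A})).
pose e' i := psi (linfun (coord (vbasis {:A}) i : A -> k^o)).
have lame' y i : lam (y * e' i) = coord (vbasis {:A}) i y.
  by rewrite -phil psiK lfunE.
have lamC x y : lam (x * y) = lam (y * x) by rewrite -phil phir.
have lam_inj y z : (forall x, lam (x * y) = lam (x * z)) -> y = z.
  by move=> yz; apply: (can_inj phiK); apply/lfunP => x; rewrite !phil yz.
exists lam, e, e'; split=> [//|y|y].
  rewrite {1}(coord_vbasis (memvf y)); apply: eq_bigr => i _.
  by congr (_ *: _); apply/esym/lame'.
apply: lam_inj => x; rewrite lamC {1}(coord_vbasis (memvf x)) !mulr_sumr.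
rewrite !linear_sum; apply: eq_bigr => i _.
rewrite -!scalerAr !linearZ /= -[_ *: lam (x * _)]mulrC.
by congr (_ * _); apply/esym/lame'.
Qed.
End SymmetricForm.

(** * Splicing and truncation of projective resolutions *)

Section ResolutionShift.
Variables (R : nzRingType).
Implicit Types M N : lmodType R.

Section Prepend.
Variables (M M' I : lmodType R) (P : proj_resolution M).
Variables (i : {linear M -> I}) (p : {linear I -> M'}).
Hypotheses (Iproj : projective I) (iinj : injective i) (psurj : surj p).
Hypothesis exact : forall x, p x = 0 <-> exists y, i y = x.

Let obj n : lmodType R := if n is m.+1 then P m else I.

Let diff n : {linear obj n.+1 -> obj n} :=
  match n with 0 => i \o res_aug P | m.+1 => res_diff P m end.

Lemma prepend_proj n : projective (obj n).
Proof. by case: n => // n; apply: res_proj. Qed.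

Lemma prepend_exact0 x : p x = 0 <-> exists y, diff 0 y = x.
Proof.
split=> [/exact[y <-]|[y <-]]; last by apply/exact; exists (res_aug P y).
by have [z <-] := res_aug_surj P y; exists z.
Qed.

Lemma prepend_exactS n x : diff n x = 0 <-> exists y, diff n.+1 y = x.
Proof.
case: n x => [|n] x; last exact: res_exactS.
rewrite -(res_exact0 x) /=; split=> [/eqP|->]; last by rewrite linear0.
by rewrite -(linear0 i) => /eqP/iinj.
Qed.

Definition prepend : proj_resolution M' :=
  ProjResolution prepend_proj psurj prepend_exact0 prepend_exactS.
End Prepend.

Section Shift.
Variables (M : lmodType R) (P : proj_resolution M).

Fact shift_aug_subproof (x : P 1) : res_diff P 0 x \in ker_pred (res_aug P).
Proof. by apply/eqP/res_exact0; exists x. Qed.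

Definition shift_aug (x : P 1) : kermod (res_aug P) :=
  exist _ (res_diff P 0 x) (shift_aug_subproof x).

Fact shift_aug_linear : linear shift_aug.
Proof. by move=> a x y; apply/val_inj; rewrite /= !linearP. Qed.
HB.instance Definition _ :=
  GRing.isLinear.Build R (P 1) (kermod (res_aug P)) _ shift_aug shift_aug_linear.

Lemma shift_aug_surj : surj shift_aug.
Proof.
move=> [y y0]; have /eqP/res_exact0[x xy] := y0.
by exists x; apply/val_inj.
Qed.

Lemma shift_exact0 x : shift_aug x = 0 <-> exists y, res_diff P 1 y = x.
Proof.
rewrite -res_exactS; split=> [/(congr1 val)|x0]; first by [].
exact/val_inj.
Qed.

Definition shift : proj_resolution (kermod (res_aug P)) :=
  @ProjResolution _ _ (fun n => P n.+1) shift_aug (fun n => res_diff P n.+1)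
    (fun n => @res_proj _ _ P n.+1) shift_aug_surj shift_exact0
    (fun n => @res_exactS _ _ P n.+1).
End Shift.
End ResolutionShift.
Arguments shift_aug {R M} P.
Arguments shift_aug_surj {R M} P.
Arguments shift_exact0 {R M P}.

(** * The Casimir element and averaging *)

Section DualBases.
Variables (k : fieldType) (A : falgType k).
Variables (lam : A -> k) (e e' : 'I_(\dim {:A}) -> A).
Hypothesis lam_e : dual_bases lam e e'.

Let lamC x y : lam (x * y) = lam (y * x). Proof. by case: lam_e. Qed.
Let dec_e y : y = \sum_i lam (y * e' i) *: e i. Proof. by case: lam_e. Qed.
Let dec_e' y : y = \sum_i lam (y * e i) *: e' i. Proof. by case: lam_e. Qed.

Section Casimir.
Variables (V : lmodType k) (b : A -> A -> V).
Hypothesis b_linl : forall v, linear (b^~ v).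
Hypothesis b_linr : forall u, linear (b u).

Let b_suml (I : finType) (c : I -> k) (x : I -> A) v :
  b (\sum_i c i *: x i) v = \sum_i c i *: b (x i) v.
Proof.
pose L := GRing.isLinear.Build k A V _ (b^~ v) (b_linl v).
pose f : {linear A -> V} := HB.pack (b^~ v) L.
by rewrite -[LHS]/(f _) linear_sum; apply: eq_bigr => i _; rewrite linearZ.
Qed.

Let b_sumr (I : finType) (c : I -> k) (x : I -> A) u :
  b u (\sum_i c i *: x i) = \sum_i c i *: b u (x i).
Proof.
pose L := GRing.isLinear.Build k A V _ (b u) (b_linr u).
pose f : {linear A -> V} := HB.pack (b u) L.
by rewrite -[LHS]/(f _) linear_sum; apply: eq_bigr => i _; rewrite linearZ.
Qed.

(** The Casimir element, the sum of the tensors of [e i] with [e' i], is central; an arbitrary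
    bilinear [b] stands in for the tensor product. Both sides expand to the same double sum by the
    trace property. *)
Lemma casimir_outer a : \sum_i b (a * e i) (e' i) = \sum_i b (e i) (e' i * a).
Proof.
transitivity (\sum_i \sum_j lam (a * e i * e' j) *: b (e j) (e' i)).
  by apply: eq_bigr => i _; rewrite {1}[a * e i]dec_e b_suml.
rewrite exchange_big; apply: eq_bigr => j _.
rewrite [e' j * a]dec_e' b_sumr; apply: eq_bigr => i _.
by rewrite -[e' j * a * _]mulrA [lam (e' j * _)]lamC.
Qed.

(** Here [a] moves between the two inner sides of the tensor factors; this is why commutators with
    [a] average to zero. *)
Lemma casimir_inner a : \sum_i b (e i * a) (e' i) = \sum_i b (e i) (a * e' i).
Proof.
transitivity (\sum_i \sum_j lam (e i * a * e' j) *: b (e j) (e' i)).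
  by apply: eq_bigr => i _; rewrite {1}[e i * a]dec_e b_suml.
rewrite exchange_big; apply: eq_bigr => j _.
rewrite [a * e' j]dec_e' b_sumr; apply: eq_bigr => i _.
by rewrite -[e i * a * _]mulrA [lam (e i * _)]lamC.
Qed.

Lemma casimir_sym : \sum_i b (e' i) (e i) = \sum_i b (e i) (e' i).
Proof.
transitivity (\sum_i \sum_j lam (e' i * e' j) *: b (e j) (e i)).
  by apply: eq_bigr => i _; rewrite {1}[e' i]dec_e b_suml.
rewrite exchange_big; apply: eq_bigr => j _.
rewrite {2}[e' j]dec_e b_sumr; apply: eq_bigr => i _.
by rewrite [lam (e' j * _)]lamC.
Qed.
End Casimir.

Section Average.
Implicit Types U V W : lmodType A.

Definition avg U V (h : restr U -> restr V) (x : U) : V :=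
  \sum_i e i *: (h (e' i *: x) : V).

Section Linear.
Variables (U V : lmodType A) (h : {linear restr U -> restr V}).

Let act_linl (x : U) v : linear (fun u : A => u *: (h (v *: x) : V) : restr V).
Proof. by move=> c u u'; rewrite scalerDl restrZl. Qed.

Let act_linr (x : U) u : linear (fun v : A => u *: (h (v *: x) : V) : restr V).
Proof.
move=> c v v'; rewrite scalerDl restrZl.
by rewrite (linearP h) scalerDr restrZr restrZl.
Qed.

Fact avg_linear : linear (avg h : U -> V).
Proof.
move=> a x y; rewrite /avg.
transitivity (\sum_i e i *: (h (e' i *: (a *: x)) : V) +
              \sum_i e i *: (h (e' i *: y) : V)).
  rewrite -big_split; apply: eq_bigr => i _ /=.
  by rewrite scalerDr (linearD h) scalerDr.
congr (_ + _); rewrite scaler_sumr.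
have := casimir_outer (act_linl x) (act_linr x) a => /= outer.
under eq_bigr do rewrite scalerA.
by rewrite -outer; apply: eq_bigr => i _; rewrite scalerA.
Qed.
HB.instance Definition _ := GRing.isLinear.Build A U V _ (avg h) avg_linear.

Lemma avg_comm a x :
  avg (fun y => h (a *: (y : U))) x = avg (fun y => a *: (h y : V)) x.
Proof.
have /= inner := casimir_inner (act_linl x) (act_linr x) a.
rewrite /avg; transitivity (\sum_i e i *: (h (a * e' i *: x) : V)).
  by apply: eq_bigr => i _; rewrite scalerA.
by rewrite -[LHS]inner; apply: eq_bigr => i _; rewrite scalerA.
Qed.

Lemma avg_sym x : \sum_i e' i *: (h (e i *: x) : V) = avg h x.
Proof. exact: (casimir_sym (act_linl x) (act_linr x)). Qed.
End Linear.

Lemma avg_compl U V W (g : {linear V -> W}) (h : restr U -> restr V) x :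
  avg (restr_map g \o h) x = g (avg h x).
Proof. by rewrite linear_sum; apply: eq_bigr => i _; rewrite linearZ. Qed.

Lemma avg_compr U V W (h : restr V -> restr W) (g : {linear U -> V}) x :
  avg (h \o restr_map g) x = avg h (g x).
Proof. by apply: eq_bigr => i _; rewrite /= /restr_map linearZ. Qed.
End Average.

(** * Cosyzygies and Ext *)

Section RelativeProjective.
Implicit Types C D I M N U V W X Z : lmodType A.

Definition avg_hom U V : Prop := forall f : {linear U -> V},
  exists h : {linear restr U -> restr V}, forall x, f x = avg h x.

(** Higman's criterion for relative projectivity, taken as definition. *)
Definition rel_proj I : Prop :=
  exists t : {linear restr I -> restr I}, forall x, avg t x = x.

Definition cosyzygy C C' : Prop :=
  exists I (i : {linear C -> I}) (p : {linear I -> C'}),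
    [/\ rel_proj I, fdim (restr I), injective i, surj p &
        forall x, p x = 0 <-> exists y, i y = x].

(** At order zero this is equality of modules, so isomorphisms are absorbed only at positive order,
    by [nth_cosyzygy_iso]. *)
Fixpoint nth_cosyzygy n C C' : Prop :=
  if n is m.+1 then exists2 W, cosyzygy C W & nth_cosyzygy m W C' else C = C'.

Lemma nth_cosyzygyD m n C C' : nth_cosyzygy (m + n) C C' <->
  exists2 W, nth_cosyzygy m C W & nth_cosyzygy n W C'.
Proof.
elim: m C => [|m IHm] C /=; first by split=> [CC'|[W ->]]; first exists C.
split=> [[W CW /IHm[V WV VC']]|[V [W CW WV] VC']].
  by exists V => //; exists W.
by exists W => //; apply/IHm; exists V.
Qed.

(** A k-linear lift [h] exists because [I] is finite dimensional; averaging [h \o t] makes it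
    [A]-linear, and it still lifts [f] since averages commute with [A]-linear maps. *)
Lemma rel_proj_projective I : rel_proj I -> fdim (restr I) -> projective I.
Proof.
move=> [t tP] Ifd U V g f gsurj.
have [h hP] := fdim_lift (restr_map f) Ifd (gsurj : surj (restr_map g)).
exists (avg (h \o t)) => x; rewrite -avg_compl -[in RHS](tP x) -avg_compl.
by apply: eq_bigr => i _; rewrite /= hP.
Qed.

(** [Ext_eq0] speaks of all resolutions, so the hypothesis applies to [P] with [I] prepended, whose
    cohomology in degree [i.+2] is by conversion that of [P] in degree [i.+1]. *)
Lemma Ext_cosyzygy C C' X i :
  cosyzygy C C' -> Ext_eq0 i.+2 C' X -> Ext_eq0 i.+1 C X.
Proof.
move=> [I [j [p [It Ifd jinj psurj exact]]]] C'X P.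
have Iproj := rel_proj_projective It Ifd.
exact: (C'X (prepend P Iproj jinj psurj exact)).
Qed.

Lemma Ext1_avg_hom C C' X : cosyzygy C C' -> Ext_eq0 1 C' X -> avg_hom C X.
Proof.
move=> [I [j [p [It Ifd jinj psurj exact]]]] C'X f.
have [P] := proj_resolution_exists C.
have Iproj := rel_proj_projective It Ifd.
(* [f \o res_aug P] is a 1-cocycle of the spliced resolution. That it is a coboundary means that [f]
   extends along [j] to [g : I -> X], and maps through [I] are averages. *)
have /= := C'X (prepend P Iproj jinj psurj exact) (f \o res_aug P).
case=> [x /=|g gP].
  have -> : res_aug P (res_diff P 0 x) = 0 by apply/res_exact0; exists x.
  exact: linear0.
have [t tP] := It.
exists ((restr_map g \o t) \o restr_map j) => x.
rewrite avg_compr avg_compl tP.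
by have [y <-] := res_aug_surj P x; apply: gP.
Qed.

Lemma Ext_nth_cosyzygy n m C C' X :
  nth_cosyzygy n C C' -> Ext_eq0 (m + n).+1 C' X -> Ext_eq0 m.+1 C X.
Proof.
elim: n m C => [|n IHn] m C; first by rewrite addn0 => /= ->.
move=> [W CW WC'] C'X; apply: (Ext_cosyzygy CW).
by apply: IHn WC' _; rewrite addSnnS.
Qed.

Lemma Ext_avg_hom n D M N :
  nth_cosyzygy n.+1 D M -> Ext_eq0 n.+1 M N -> avg_hom D N.
Proof.
move=> [W DW WM] MN; apply: (Ext1_avg_hom DW).
exact: (@Ext_nth_cosyzygy n 0) WM MN.
Qed.

(** Cosyzygies are functorial modulo averages: [u] lifts to [v : I -> J], which restricts to
    [w : D -> C]. Once the average of an extension of [h] is subtracted, [v] factors through [D'],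
    so [u] factors through [J]. *)
Lemma avg_hom_cosyzygy D D' C C' :
  cosyzygy D D' -> cosyzygy C C' -> avg_hom D C -> avg_hom D' C'.
Proof.
move=> [I [i [p [It Ifd iinj psurj pexact]]]].
move=> [J [j [q [[t tP] Jfd jinj qsurj qexact]]]] DC u.
have Iproj := rel_proj_projective It Ifd.
have [v vP] := Iproj _ _ q (u \o p) qsurj.
have [|w wP] := @factor_mono _ _ _ _ j (v \o i) jinj.
  move=> x; apply/qexact; rewrite /= vP /=.
  suff -> : p (i x) = 0 by rewrite linear0.
  by apply/pexact; exists x.
have [h hP] := DC w.
have [r rK] := fdim_retract Ifd (iinj : injective (restr_map i)).
pose hI : {linear restr I -> restr J} := restr_map j \o (h \o r).
have hIE x : avg hI (i x) = v (i x).
  rewrite -avg_compr -[RHS]wP hP -avg_compl.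
  by apply: eq_bigr => l _; rewrite /= rK.
have [|z zP] := @factor_epi _ _ _ _ p (v \- avg hI) psurj.
  by move=> x /pexact[y <-]; rewrite /= hIE subrr.
exists (restr_map q \o (t \o restr_map z)) => x.
rewrite avg_compl avg_compr tP.
have [y <-] := psurj x; rewrite zP /= linearB vP /= avg_compl.
suff -> : q (j (avg (h \o r) y)) = 0 by rewrite subr0.
by apply/qexact; exists (avg (h \o r) y).
Qed.

Lemma avg_hom_nth_cosyzygy n D D' C C' :
  nth_cosyzygy n D D' -> nth_cosyzygy n C C' -> avg_hom D C -> avg_hom D' C'.
Proof.
elim: n D C => [|n IHn] D C /=; first by move=> -> ->.
move=> [V DV VD'] [W CW WC'] DC.
exact: IHn VD' WC' (avg_hom_cosyzygy DV CW DC).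
Qed.

(** [Z] is a retract of [N] modulo maps through projectives. This one-sided relation suffices to
    transport vanishing, and it passes to syzygies in arbitrary resolutions. *)
Definition stable_retract Z N : Prop :=
  exists (Q : lmodType A) (a : {linear Z -> N}) (b : {linear N -> Z})
    (u : {linear Z -> Q}) (v : {linear Q -> Z}),
    projective Q /\ forall x, b (a x) = x + v (u x).

Lemma stable_retract_refl N : stable_retract N N.
Proof.
have [P] := proj_resolution_exists N.
exists (P 0), idfun, idfun, \0, \0; split; first exact: res_proj.
by move=> x /=; rewrite addr0.
Qed.

(* As in Schanuel's lemma: on [ker q], [b \o a] is the identity up to a map
   [w] that extends to [P0] with values in [ker q]. *)
Lemma stable_retract_lift Z C' (P0 : lmodType A) I
    (q : {linear P0 -> Z}) (p : {linear I -> C'}) :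
  projective P0 -> projective I -> surj q -> surj p -> stable_retract Z C' ->
  exists (a : {linear P0 -> I}) (b : {linear I -> P0}) (w : {linear P0 -> P0}),
    [/\ forall x, q x = 0 -> p (a x) = 0, forall y, p y = 0 -> q (b y) = 0,
        forall x, q (w x) = 0 & forall x, q x = 0 -> b (a x) = x + w x].
Proof.
move=> P0proj Iproj qsurj psurj [Q [al [be [u [v [Qproj albe]]]]]].
have [a aP] := P0proj _ _ p (al \o q) psurj.
have [b bP] := Iproj _ _ q (be \o p) qsurj.
have [v' v'P] := Qproj _ _ q v qsurj.
exists a, b, ((b \o a) \- (idfun \+ (v' \o (u \o q)))).
split=> [x qx|y py|x|x qx] /=.
- by rewrite aP /= qx linear0.
- by rewrite bP /= py linear0.
- by rewrite linearB linearD bP /= aP /= v'P albe subrr.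
- by rewrite qx !linear0 addr0 addrC subrK.
Qed.

(** Restricted to the kernels, [a] and [b] compose to the identity plus [v \o inc], which passes
    through the projective [P 0]. *)
Lemma stable_retract_syzygy C C' Z (P : proj_resolution Z) :
  cosyzygy C C' -> stable_retract Z C' -> stable_retract (kermod (res_aug P)) C.
Proof.
move=> [I [i [p [It Ifd iinj psurj exact]]]] ZC'.
have Iproj := rel_proj_projective It Ifd.
have [a [b [w [pa qb qw baw]]]] :=
  stable_retract_lift (@res_proj _ _ P 0) Iproj (res_aug_surj P) psurj ZC'.
have [inc [_ incinj inc0 inck]] := kermod_inclusion (res_aug P).
have [|a' a'P] := @factor_mono _ _ _ _ i (a \o inc) iinj.
  by move=> x; apply/exact/pa.
have [|b' b'P] := @factor_mono _ _ _ _ inc (b \o i) incinj.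
  by move=> x; apply/inck/qb/exact; exists x.
have [|v vP] := @factor_mono _ _ _ _ inc w incinj; first by move=> x; apply/inck.
exists (P 0), a', b', inc, v; split; first exact: res_proj.
by move=> x; apply: incinj; rewrite b'P /= a'P /= baw // linearD vP.
Qed.

(** A cocycle [f] descends to [f'] on the first syzygy. The composite [f' \o b'] on [C] is an
    average, so it extends to [I]; pulling back by [a] recovers [f] up to the term [f' \o v], which
    is already defined on [P 0]. *)
Lemma avg_hom_Ext1 C C' Z X (P : proj_resolution Z) :
  cosyzygy C C' -> stable_retract Z C' -> avg_hom C X -> cohomology_eq0 P X 1.
Proof.
move=> [I [i [p [It Ifd iinj psurj exact]]]] ZC' CX f f0.
have Iproj := rel_proj_projective It Ifd.
have [a [b [w [pa qb qw baw]]]] :=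
  stable_retract_lift (@res_proj _ _ P 0) Iproj (res_aug_surj P) psurj ZC'.
pose d : {linear P 1 -> kermod (res_aug P)} := shift_aug P.
have [|f' f'P] := @factor_epi _ _ _ _ d f (shift_aug_surj P).
  by move=> x /shift_exact0[y <-].
have [inc [incE incinj inc0 inck]] := kermod_inclusion (res_aug P).
have incd x : inc (d x) = res_diff P 0 x by rewrite incE.
have [|b' b'P] := @factor_mono _ _ _ _ inc (b \o i) incinj.
  by move=> x; apply/inck/qb/exact; exists x.
have [|v vP] := @factor_mono _ _ _ _ inc w incinj; first by move=> x; apply/inck.
have [h hP] := CX (f' \o b').
have [r rK] := fdim_retract Ifd (iinj : injective (restr_map i)).
exists ((avg (h \o r) \o a) \- (f' \o v)) => x /=.
have dx0 : res_aug P (res_diff P 0 x) = 0 by apply/res_exact0; exists x.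
have /exact[c cP] := pa _ dx0.
have -> : avg (h \o r) (a (res_diff P 0 x)) = f' (b' c).
  rewrite -cP -avg_compr [RHS]hP.
  by apply: eq_bigr => l _; rewrite /= rK.
rewrite -f'P -linearB; congr (f' _); apply: incinj.
by rewrite linearB b'P vP /= cP baw // addrK incd.
Qed.

Lemma avg_hom_Ext_retract m C C' Z X (P : proj_resolution Z) :
  nth_cosyzygy m.+1 C C' -> stable_retract Z C' -> avg_hom C X ->
  cohomology_eq0 P X m.+1.
Proof.
move=> CC' ZC' CX; elim: m C' Z P CC' ZC' => [|m IHm] C' Z P.
  by move=> [W CW /= <-] ZW; apply: avg_hom_Ext1 CW ZW CX.
move=> CC' ZC'.
(* The last cosyzygy is peeled off, the one matched with the augmentation of [P]; truncating [P]
   then lowers the degree by one. *)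
have /nth_cosyzygyD[W CW [V WV /= VC']] : nth_cosyzygy (m.+1 + 1) C C'.
  by rewrite addn1.
rewrite -VC' in ZC'.
exact: (IHm W _ (shift P) CW (stable_retract_syzygy P WV ZC')).
Qed.

Lemma avg_hom_Ext m C C' X :
  nth_cosyzygy m.+1 C C' -> avg_hom C X -> Ext_eq0 m.+1 C' X.
Proof.
by move=> CC' CX P; apply: avg_hom_Ext_retract CC' (stable_retract_refl _) CX.
Qed.

(** * Trace duality between maps [U -> V] and [V -> U] *)

Section Duality.
Variables U V : lmodType A.
Hypotheses (Ufd : fdim (restr U)) (Vfd : fdim (restr V)).

(* The trace form pairs k-linear maps U -> V and V -> U perfectly; [avg] is
   self-adjoint for it, and the orthogonal of the commutators consists of the
   A-linear maps. *)
Lemma avg_hom_commutators : avg_hom U V ->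
  forall g : {linear restr V -> restr U}, (forall x, avg g x = 0) ->
  exists gs : 'I_(\dim {:A}) -> {linear restr V -> restr U},
    forall x, g x = \sum_j (e j *: (gs j x : U) - (gs j (e j *: (x : V)) : U)).
Proof.
move=> UV g g0.
have [m [x /linear_inverse[x' [xK x'K]]]] := Ufd.
have [n [y /linear_inverse[y' [yK y'K]]]] := Vfd.
pose RU a : 'M_m := lin1_mx (x \o (restr_act U a \o x')).
pose RV a : 'M_n := lin1_mx (y \o (restr_act V a \o y')).
have xE a (u : U) : x (a *: u) = x u *m RU a by rewrite mul_rV_lin1 /= xK.
have yE a (v : V) : y (a *: v) = y v *m RV a by rewrite mul_rV_lin1 /= yK.
pose G := lin1_mx (x \o (g \o y')).
have gE v : x (g v) = y v *m G by rewrite mul_rV_lin1 /= yK.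
(* Matrices act on rows from the right, so [T j] sends the matrix of a map to that of its commutator
   with [e j]. *)
pose T j : {linear 'M[k]_(n, m) -> 'M[k]_(n, m)} :=
  mulmxr (RU (e j)) \- mulmx (RV (e j)).
have [|Ys YsP] := @mxtrace_separation k m n _ T G; last first.
  exists (fun j => x' \o (mulmxr (Ys j) \o y)) => v.
  apply: (can_inj xK); rewrite gE YsP mulmx_sumr linear_sum.
  apply: eq_bigr => j _.
  by rewrite (linearB x) xE /= !x'K yE mulmxBr !mulmxA.
move=> F FT.
(* Orthogonality to all commutators forces [F] to commute with each [e j], hence to be the matrix of
   an [A]-linear map. *)
have comF j : RU (e j) *m F = F *m RV (e j).
  apply/eqP; rewrite -subr_eq0; apply/eqP/mxtrace_eq0 => Y.
  rewrite mulmxBr linearB /= -[RHS](FT j Y) /T /= mulmxBl linearB /=.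
  by rewrite mulmxA; congr (_ - _); rewrite mulmxA mxtrace_mulC mulmxA.
pose f : {linear restr U -> restr V} := y' \o (mulmxr F \o x).
have fe j u : f (e j *: (u : U)) = e j *: (f u : V).
  by apply: (can_inj yK); rewrite yE /= !y'K xE -!mulmxA comF.
have fl : linear (f : U -> V).
  move=> a u u'; rewrite (linearD f); congr (_ + _).
  rewrite {1 2}[a]dec_e !scaler_suml (linear_sum f); apply: eq_bigr => j _.
  by rewrite !restrZl (linearZ_LR f) fe.
pose L := GRing.isLinear.Build A U V _ (f : U -> V) fl.
have [h hP] := UV (HB.pack (f : U -> V) L : {linear U -> V}).
pose H := lin1_mx (y \o (h \o x')).
have hE u : y (h u) = x u *m H by rewrite mul_rV_lin1 /= xK.
(* [F] is the average of [H]; cycling the trace moves the sum over the dual bases onto [G], where it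
   vanishes by the symmetry of the Casimir element. *)
have -> : F = \sum_i RU (e' i) *m H *m RV (e i).
  apply/row_matrixP => l; rewrite !rowE.
  transitivity (y (f (x' (delta_mx 0 l)))); first by rewrite /= y'K x'K.
  rewrite -[f _]/((HB.pack (f : U -> V) L : {linear U -> V}) _) hP.
  rewrite mulmx_sumr (linear_sum y); apply: eq_bigr => i _.
  by rewrite yE hE xE x'K !mulmxA.
rewrite mulmx_sumr linear_sum /=.
transitivity (\tr (\sum_i RV (e i) *m G *m RU (e' i) *m H)).
  rewrite linear_sum; apply: eq_bigr => i _ /=.
  by rewrite mulmxA mxtrace_mulC !mulmxA.
rewrite -mulmx_suml.
suff -> : \sum_i RV (e i) *m G *m RU (e' i) = 0 by rewrite mul0mx mxtrace0.
apply/row_matrixP => l; rewrite !rowE mulmx0 mulmx_sumr.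
transitivity (x (avg g (y' (delta_mx 0 l)))); last by rewrite g0 linear0.
rewrite -(avg_sym) (linear_sum x); apply: eq_bigr => i _.
by rewrite xE gE yE y'K !mulmxA.
Qed.
End Duality.

(* If [u : C -> X] is to be averaged, [u \o p] on the relatively projective
   middle term is the average of some [w], whose restriction to [C0] has
   average zero, hence is a sum of commutators; correcting [w] by extensions
   of these makes it factor through [p]. *)
Lemma avg_hom_dual C0 C X : fdim (restr X) -> cosyzygy C0 C ->
  avg_hom X C0 -> avg_hom C X.
Proof.
move=> Xfd [I [i [p [[t tP] Ifd iinj psurj exact]]]] XC0 u.
have [r rK] := fdim_retract Ifd (iinj : injective (restr_map i)).
have C0fd := fdim_sub (iinj : injective (restr_map i)) Ifd.
pose w : {linear restr I -> restr X} := restr_map u \o (restr_map p \o t).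
have wE x : avg w x = u (p x) by rewrite !avg_compl tP.
have [|gs gsP] := avg_hom_commutators Xfd C0fd XC0 (g := w \o restr_map i).
  move=> x; rewrite avg_compr wE.
  suff -> : p (i x) = 0 by rewrite linear0.
  by apply/exact; exists x.
pose com j : {linear restr I -> restr X} :=
  (restr_act X (e j) \o (gs j \o r)) \- ((gs j \o r) \o restr_act I (e j)).
have [c cP] := linear_bigsum com.
have c0 x : avg c x = 0.
  transitivity (\sum_j avg (com j) x).
    rewrite exchange_big; apply: eq_bigr => l _ /=.
    by rewrite cP scaler_sumr.
  rewrite big1 // => j _.
  have /eqP := avg_comm (gs j \o r) (e j) x.
  rewrite eq_sym -subr_eq0 => /eqP <-; rewrite -sumrB.
  by apply: eq_bigr => l _; rewrite -scalerBr.
have [|v vP] := @factor_epi _ _ _ _ (restr_map p) (w \- c) psurj.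
  move=> x /exact[y <-].
  rewrite -[LHS]/((w \o restr_map i) y - c (i y)) gsP cP.
  rewrite -sumrB big1 // => j _ /=.
  (* Although [r] is only k-linear, it sends [e j *: i y] to [e j *: y], because [i] is
     [A]-linear. *)
  rewrite rK /restr_act -[r (e j *: i y)]/(r (e j *: (i y : I))) -linearZ /=.
  by rewrite (rK (e j *: y)) subrr.
exists v => x; have [y <-] := psurj x; rewrite -avg_compr.
transitivity (avg w y - avg c y); first by rewrite c0 subr0 wE.
rewrite -sumrB; apply: eq_bigr => l _.
by rewrite -scalerBr; congr (_ *: _); rewrite /= vP.
Qed.

(** The property of being averages passes from maps [D -> N] to maps [M -> C] by cosyzygies, then to
    maps [W -> M] by duality, [W] being the next cosyzygy after [C]; this extra step accounts for
    [m.+2]. *)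
Lemma Ext_symmetry n m N M C D :
  fdim (restr M) -> nth_cosyzygy n.+1 D M -> nth_cosyzygy n.+1 N C ->
  nth_cosyzygy m.+2 C N -> Ext_eq0 n.+1 M N -> Ext_eq0 m.+1 N M.
Proof.
move=> Mfd DM NC [W CW WN] MN; apply: avg_hom_Ext WN _.
apply: avg_hom_dual Mfd CW _.
exact: avg_hom_nth_cosyzygy DM NC (Ext_avg_hom DM MN).
Qed.
End RelativeProjective.
End DualBases.

(** * Homomorphisms from bimodules *)

Section LeftRestriction.
Variables (k : fieldType) (A : falgType k).
Local Notation E := (enveloping A).
Implicit Types B K P : lmodType E.

Definition lten (a : A) : E := ptens a (1 : A^c).
Definition rten (a : A) : E := ptens (1 : A) (a : A^c).

Lemma ltenM a b : lten (a * b) = lten a * lten b.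
Proof. by rewrite /lten ptensM mulr1. Qed.

Lemma ltenD a b : lten (a + b) = lten a + lten b.
Proof. by have := ptens_linl (1 : A^c) 1 a b; rewrite !scale1r. Qed.

Lemma ltenZ c a : lten (c *: a) = c *: lten a.
Proof. exact: ptensZl. Qed.

Lemma rtenM a b : rten (b * a) = rten a * rten b.
Proof. by rewrite /rten ptensM mulr1. Qed.

Lemma rtenD a b : rten (a + b) = rten a + rten b.
Proof. by have := ptens_linr (1 : A) 1 (a : A^c) b; rewrite !scale1r. Qed.

Lemma rtenZ c a : rten (c *: a) = c *: rten a.
Proof. exact: (ptensZr c (1 : A) (a : A^c)). Qed.

Lemma lrten a b : lten a * rten b = ptens a (b : A^c).
Proof. by rewrite /lten /rten ptensM mulr1 mul1r. Qed.

Lemma rlten a b : rten b * lten a = ptens a (b : A^c).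
Proof. by rewrite /lten /rten ptensM mulr1 mul1r. Qed.

Definition lres B : Type := B.
HB.instance Definition _ B := GRing.Zmodule.on (lres B).

Definition lres_scale B (a : A) (x : lres B) : lres B := lten a *: (x : B).

Section Laws.
Variable B : lmodType E.
Fact lres_scaleA a b (x : lres B) :
  lres_scale a (lres_scale b x) = lres_scale (a * b) x.
Proof. by rewrite /lres_scale scalerA ltenM. Qed.
Fact lres_scale1 : left_id 1 (@lres_scale B).
Proof. by move=> x; apply: scale1r. Qed.
Fact lres_scaleDr : right_distributive (@lres_scale B) +%R.
Proof. by move=> a x y; apply: scalerDr. Qed.
Fact lres_scaleDl (x : lres B) : {morph (@lres_scale B)^~ x : a b / a + b}.
Proof. by move=> a b; rewrite /lres_scale ltenD [LHS]scalerDl. Qed.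
HB.instance Definition _ := GRing.Zmodule_isLmodule.Build A (lres B)
  lres_scaleA lres_scale1 lres_scaleDr lres_scaleDl.
End Laws.

Lemma lresE B a (x : B) : a *: (x : lres B) = lten a *: x.
Proof. by []. Qed.

Definition lres_map B B' (f : B -> B') : lres B -> lres B' := f.
Fact lres_map_linear B B' (f : {linear B -> B'}) : linear (lres_map f).
Proof. by move=> a x y; apply: linearP. Qed.
HB.instance Definition _ B B' (f : {linear B -> B'}) :=
  GRing.isLinear.Build A (lres B) (lres B') _ (lres_map f) (lres_map_linear f).

Definition ract B (a : A) (x : lres B) : lres B := rten a *: (x : B).
Fact ract_linear B a : linear (@ract B a).
Proof.
by move=> b x y; rewrite /ract !lresE scalerDr !scalerA rlten -lrten.
Qed.
HB.instance Definition _ B a :=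
  GRing.isLinear.Build A (lres B) (lres B) _ (@ract B a) (@ract_linear B a).

Lemma fdim_lres B : fdim (restr B) -> fdim (restr (lres B)).
Proof.
have idl : linear (fun x : restr B => (x : restr (lres B))).
  by move=> c x y; congr (_ + _); rewrite !restrZE lresE ltenZ.
pose L := GRing.isLinear.Build k (restr B) (restr (lres B)) _ _ idl.
apply: (@fdim_quot _ _ _
  (HB.pack (fun x : restr B => (x : restr (lres B))) L : {linear _ -> _})).
by move=> x; exists x.
Qed.

(** [contract mu] is [id (x) mu : A (x) A^op -> A]. *)
Definition contract (mu : A -> k) (t : E) : A :=
  \sum_i \sum_j (t i j * mu (vbasis {:A^c})`_j) *: (vbasis {:A})`_i.

Section Contract.
Variable mu : {linear A -> k^o}.

Fact contract_linear : linear (contract mu).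
Proof.
move=> c s t; rewrite /contract scaler_sumr -big_split; apply: eq_bigr => i _.
rewrite scaler_sumr -big_split; apply: eq_bigr => j _ /=.
by rewrite !mxE mulrDl scalerDl -mulrA scalerA.
Qed.
HB.instance Definition _ :=
  GRing.isLinear.Build k E A _ (contract mu) contract_linear.

Lemma contractD s t : contract mu (s + t) = contract mu s + contract mu t.
Proof. exact: linearD. Qed.

Lemma contract_ptens (a : A) (b : A^c) : contract mu (ptens a b) = mu b *: a.
Proof.
rewrite [in RHS](coord_vbasis (memvf a)) scaler_sumr; apply: eq_bigr => i _.
have -> : mu b = \sum_j coord (vbasis {:A^c}) j b * mu (vbasis {:A^c})`_j.
  rewrite {1}(coord_vbasis (memvf b)) (linear_sum mu); apply: eq_bigr => j _.
  exact: (linearZ_LR mu).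
rewrite scaler_suml; apply: eq_bigr => j _.
by rewrite mxE scalerA; congr (_ *: _); rewrite -mulrA mulrC.
Qed.

Lemma contract_lten a t : contract mu (lten a * t) = a * contract mu t.
Proof.
elim/tens_ind: t => [s t IHs IHt|b c].
  by rewrite mulrDr !contractD IHs IHt mulrDr.
by rewrite /lten ptensM mul1r !contract_ptens scalerAr.
Qed.
End Contract.

(** The images under [rten] of a basis span the enveloping algebra as a left [A]-module, with
    coordinates given by [contract]. *)
Lemma contract_coord (t : E) : t = \sum_j
  lten (contract (coord (vbasis {:A^c}) j : {linear A -> k^o}) t) *
  rten (vbasis {:A^c})`_j.
Proof.
elim/tens_ind: t => [s t IHs IHt|a b].
  rewrite {1}IHs {1}IHt -big_split; apply: eq_bigr => j _ /=.
  by rewrite contractD ltenD mulrDl.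
rewrite {1}(coord_vbasis (memvf b)) ptens_sumr; apply: eq_bigr => j _.
by rewrite contract_ptens lrten ptensZl ptensZr.
Qed.

(** Such a bimodule is a summand of a power of the enveloping algebra, which is free on the left.
    Concretely, lifts [u] of the images of the left generators are recombined with left
    coordinates. *)
Lemma projective_lres B : projective B -> fin_gen B -> projective (lres B).
Proof.
move=> Bproj Bfg U V g f gsurj.
have [n [b [s sP]]] := projective_dual_basis Bproj Bfg.
have [u uP] := choice (fun ij : 'I_n * 'I_(\dim {:A^c}) =>
  gsurj (f (rten (vbasis {:A^c})`_(ij.2) *: b ij.1))).
pose c j := contract (coord (vbasis {:A^c}) j : {linear A -> k^o}).
pose h (x : lres B) : U := \sum_l \sum_j c j (s x 0 l) *: u (l, j).
have hl : linear h.
  move=> a x y; rewrite /h scaler_sumr -big_split; apply: eq_bigr => l _ /=.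
  rewrite scaler_sumr -big_split; apply: eq_bigr => j _ /=.
  rewrite [s _]linearP !mxE /c contractD [contract _ (_ * _)]contract_lten.
  by rewrite scalerDl scalerA.
pose L := GRing.isLinear.Build A (lres B) U _ h hl.
exists (HB.pack h L : {linear lres B -> U}) => x.
rewrite [x in RHS]sP !linear_sum; apply: eq_bigr => l _.
rewrite linear_sum; transitivity (\sum_j
  f (lten (c j (s x 0 l)) *: (rten (vbasis {:A^c})`_j *: b l))).
  apply: eq_bigr => j _; rewrite linearZ uP.
  exact: esym (linearZ_LR f (c j (s x 0 l)) (rten _ *: b l : lres B)).
rewrite -linear_sum; congr (f _); rewrite {2}[s x 0 l]contract_coord scaler_suml.
by apply: eq_bigr => j _; rewrite scalerA.
Qed.

Lemma projective_lres_bimod : projective (lres (bimod A)).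
Proof.
move=> U V g f gsurj; have [u uP] := gsurj (f (1 : A)).
have hl : linear (fun a : lres (bimod A) => (a : A) *: u).
  by move=> a x y; rewrite lresE /lten ptens_bimodE mulr1 scalerDl scalerA.
pose L := GRing.isLinear.Build A (lres (bimod A)) U _ _ hl.
exists (HB.pack (fun a : lres (bimod A) => (a : A) *: u) L : {linear _ -> _}) => x.
rewrite /= linearZ uP -linearZ /=; congr (f _).
by rewrite lresE /lten ptens_bimodE !mulr1.
Qed.

(** Left projectivity of [K] splits the bimodule sequence on the left, which keeps it exact under
    [Hom_A(-, N)]. *)
Lemma projective_split B B' K (q : {linear B -> K}) (j : {linear B' -> B}) :
  projective (lres K) -> surj q -> injective j ->
  (forall x, q x = 0 <-> exists y, j y = x) ->
  exists r : {linear lres B -> lres B'}, forall x, r (j x) = x.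
Proof.
move=> Kproj qsurj jinj exact.
have [s sP] := Kproj _ _ (lres_map q) idfun qsurj.
have [|r rP] := @factor_mono _ _ _ _ (lres_map j)
    (idfun \- (s \o lres_map q)) jinj.
  by move=> x; apply/exact; rewrite -[LHS]/(lres_map q _) linearB sP subrr.
exists r => x; apply: jinj; rewrite -[LHS]/(lres_map j _) rP /=.
suff -> : lres_map q (j x) = 0 by rewrite linear0 subr0.
by apply/exact; exists x.
Qed.

(** * The left module of homomorphisms from a bimodule *)

Section Bihom.
Variables (B : lmodType E) (N : lmodType A).

(** [Hom_A(B, N)] with the left action [(a f)(x) = f (x a)]. *)
Definition bihom : Type := {linear lres B -> N}.
HB.instance Definition _ := gen_eqMixin bihom.
HB.instance Definition _ := gen_choiceMixin bihom.

Lemma bihomP (f g : bihom) : (forall x : B, f x = g x) -> f = g.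
Proof.
case: f g => [f [[f1] [f2]]] [g [[g1] [g2]]] /= fg.
have fgE : f = g by apply/funext.
rewrite {}fgE in f1 f2 fg *.
by rewrite (Prop_irrelevance f1 g1) (Prop_irrelevance f2 g2).
Qed.

Let add (f g : bihom) : bihom := f \+ g.
Let opp (f : bihom) : bihom := \- f.
Let zero : bihom := \0.

Fact bihom_addA : associative add.
Proof. by move=> f g h; apply: bihomP => x /=; rewrite addrA. Qed.
Fact bihom_addC : commutative add.
Proof. by move=> f g; apply: bihomP => x /=; rewrite addrC. Qed.
Fact bihom_add0 : left_id zero add.
Proof. by move=> f; apply: bihomP => x /=; rewrite add0r. Qed.
Fact bihom_addN : left_inverse zero opp add.
Proof. by move=> f; apply: bihomP => x /=; rewrite addNr. Qed.
HB.instance Definition _ := GRing.isZmodule.Build bihom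
  bihom_addA bihom_addC bihom_add0 bihom_addN.

Lemma bihomD (f g : bihom) x : (f + g) x = f x + g x. Proof. by []. Qed.
Lemma bihom0 x : (0 : bihom) x = 0. Proof. by []. Qed.

Definition bihom_scale (a : A) (f : bihom) : bihom := f \o ract a.

Fact bihom_scaleA a b f : bihom_scale a (bihom_scale b f) = bihom_scale (a * b) f.
Proof. by apply: bihomP => x /=; rewrite /ract rtenM scalerA. Qed.
Fact bihom_scale1 : left_id 1 bihom_scale.
Proof. by move=> f; apply: bihomP => x /=; congr (f _); apply: scale1r. Qed.
Fact bihom_scaleDr : right_distributive bihom_scale +%R.
Proof. by move=> a f g; apply: bihomP. Qed.
Fact bihom_scaleDl f : {morph bihom_scale^~ f : a b / a + b}.
Proof.
move=> a b; apply: bihomP => x.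
rewrite bihomD -[RHS](linearD f) -[LHS]/(f (rten (a + b) *: (x : B))) rtenD.
by congr (f _); apply: (scalerDl (x : B) (rten a) (rten b)).
Qed.
HB.instance Definition _ := GRing.Zmodule_isLmodule.Build A bihom
  bihom_scaleA bihom_scale1 bihom_scaleDr bihom_scaleDl.

Lemma bihom_sum (I : finType) (F : I -> bihom) x :
  (\sum_i F i) x = \sum_i F i x.
Proof.
exact: (big_morph (fun f : bihom => f x) (fun f g => bihomD f g x) (bihom0 x)).
Qed.

Lemma bihomZ a (f : bihom) x : (a *: f) x = f (rten a *: x). Proof. by []. Qed.

Lemma fdim_bihom : fdim (restr B) -> fdim (restr N) -> fdim (restr bihom).
Proof.
move=> /fdim_lres[m [b /linear_inverse[b' [bK b'K]]]].
move=> [n [c /linear_inverse[c' [cK c'K]]]].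
pose F (f : restr bihom) : 'M_(m, n) :=
  lin1_mx (c \o (restr_map (f : bihom) \o b')).
have FE (f : restr bihom) x : c ((f : bihom) x) = b x *m F f.
  by rewrite mul_rV_lin1 /= bK.
have Fl : linear F.
  move=> a f g; apply/row_matrixP => i; rewrite !rowE.
  rewrite mulmxDr -scalemxAr -[delta_mx 0 i]b'K -!FE -linearP; congr (c _).
  rewrite restrZE bihomD; congr (_ + _).
  rewrite bihomZ restrZE -linearZ; congr ((f : bihom) _).
  (* Scalars act on [bihom] through the right factor and on [N] from the left; both become the same
     scalar of the enveloping algebra. *)
  by rewrite lresE ltenZ rtenZ.
pose L := GRing.isLinear.Build k (restr bihom) 'M_(m, n) _ F Fl.
apply: (@fdim_sub _ _ _ (HB.pack F L : {linear restr bihom -> 'M_(m, n)}));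
  last exact: fdim_mx.
move=> f g /= Ffg; apply: bihomP => x; apply: (can_inj cK).
by rewrite !FE Ffg.
Qed.
End Bihom.

Definition bihom_comp B B' N (g : {linear lres B -> lres B'}) (f : bihom B' N) :
  bihom B N := f \o g.

Section BimoduleMap.
Variables (B B' : lmodType E) (N : lmodType A) (g : {linear B -> B'}).

Fact bihom_comp_linear : linear (bihom_comp (N := N) (lres_map g)).
Proof.
move=> a f f'; apply: bihomP => x; congr (f _ + _).
by rewrite /= /lres_map /ract linearZ.
Qed.
HB.instance Definition _ := GRing.isLinear.Build A (bihom B' N) (bihom B N) _
  (bihom_comp (N := N) (lres_map g)) bihom_comp_linear.
End BimoduleMap.

Lemma bihom_iso B B' N : mod_iso B B' -> mod_iso (bihom B N) (bihom B' N).
Proof.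
move=> [f /linear_inverse[f' [fK f'K]]].
exists (bihom_comp (N := N) (lres_map f')).
exists (bihom_comp (N := N) (lres_map f)) => h;
  apply: bihomP => x; congr (h _); [exact: fK|exact: f'K].
Qed.

Lemma bihom_bimod_iso N : mod_iso (bihom (bimod A) N) N.
Proof.
have evl : linear (fun f : bihom (bimod A) N => f (1 : A)).
  move=> a f g; rewrite bihomD bihomZ; congr (_ + _).
  rewrite /rten ptens_bimodE !mul1r -[LHS]/(f (a : A)) -linearZ; congr (f _).
  by rewrite lresE /lten ptens_bimodE !mulr1.
pose L := GRing.isLinear.Build A (bihom (bimod A) N) N _ _ evl.
exists (HB.pack (fun f : bihom (bimod A) N => f (1 : A)) L : {linear _ -> _}).
have hl (u : N) : linear (fun a : lres (bimod A) => (a : A) *: u).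
  by move=> a x y; rewrite lresE /lten ptens_bimodE mulr1 scalerDl scalerA.
pose h u : bihom (bimod A) N :=
  HB.pack (fun a : lres (bimod A) => (a : A) *: u)
   (GRing.isLinear.Build A (lres (bimod A)) N _ _ (hl u)).
exists h => [f|u] /=; last exact: scale1r.
apply: bihomP => x; rewrite -[LHS]/((x : A) *: f (1 : A)) -linearZ; congr (f _).
by rewrite lresE /lten ptens_bimodE !mulr1.
Qed.

(** * From bimodule syzygies to cosyzygies of modules *)

Section Cosyzygies.
Variables (lam : {linear A -> k^o}) (e e' : 'I_(\dim {:A}) -> A).
Hypothesis lam_e : dual_bases lam e e'.

(* On [A (x) A^op] itself, [a (x) b |-> lam b (a (x) 1)] is left linear and
   averages to the identity for the right action. *)
Lemma right_average (t : E) :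
  \sum_i rten (e' i) * lten (contract lam (rten (e i) * t)) = t.
Proof.
elim/tens_ind: t => [s t IHs IHt|a b].
  rewrite -[RHS](congr2 +%R IHs IHt) -big_split; apply: eq_bigr => i _ /=.
  by rewrite mulrDr contractD ltenD mulrDr.
have [_ _ dec_e'] := lam_e.
rewrite [b in RHS](dec_e' (b : A)) ptens_sumr; apply: eq_bigr => i _.
by rewrite [rten (e i) * _]ptensM mul1r contract_ptens rlten ptensZl -ptensZr.
Qed.

(** The required k-linear map is precomposition with [th], which applies [lam] to the right factor
    of each coordinate; its average reduces to [right_average]. *)
Lemma rel_proj_bihom P N : projective P -> fin_gen P -> rel_proj e e' (bihom P N).
Proof.
move=> Pproj Pfg; have [n [g [s sP]]] := projective_dual_basis Pproj Pfg.
pose th (x : lres P) : lres P := \sum_l lten (contract lam (s x 0 l)) *: g l.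
have thl : linear th.
  move=> a x y; rewrite lresE /th scaler_sumr -big_split.
  apply: eq_bigr => l _ /=.
  rewrite [s _]linearP !mxE contractD [contract _ (_ * _)]contract_lten.
  rewrite ltenD scalerDl ltenM; congr (_ + _).
  by rewrite -[RHS]/(lten a *: (lten _ *: g l)) scalerA.
pose Th : {linear lres P -> lres P} :=
  HB.pack th (GRing.isLinear.Build A (lres P) (lres P) _ th thl).
pose t (f : restr (bihom P N)) : restr (bihom P N) := bihom_comp Th (f : bihom P N).
have tl : linear t.
  move=> c f f'; apply: bihomP => x.
  have cf (h : restr (bihom P N)) y :
      (c *: h : bihom P N) y = c%:A *: (h : bihom P N) y.
    rewrite restrZE bihomZ -linearZ; congr ((h : bihom P N) _).
    by rewrite lresE ltenZ rtenZ.
  transitivity ((c *: f : bihom P N) (th x) + (f' : bihom P N) (th x)); first by [].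
  transitivity ((c *: t f : bihom P N) x + (t f' : bihom P N) x); last by [].
  by rewrite !cf.
exists (HB.pack t (GRing.isLinear.Build k (restr (bihom P N)) _ _ t tl)
  : {linear restr (bihom P N) -> restr (bihom P N)}) => f.
apply: bihomP => x; rewrite bihom_sum.
transitivity (\sum_i f (rten (e' i) *: (th (rten (e i) *: (x : P)) : P) : lres P)).
  by apply: eq_bigr => i _; rewrite bihomZ.
rewrite -linear_sum; congr (f _).
transitivity (\sum_i \sum_l
  (rten (e' i) * lten (contract lam (rten (e i) * s x 0 l))) *: g l).
  apply: eq_bigr => i _; rewrite scaler_sumr; apply: eq_bigr => l _.
  by rewrite scalerA linearZ mxE.
rewrite exchange_big [RHS]sP; apply: eq_bigr => l _.
by rewrite -scaler_suml right_average.
Qed.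

(** [Hom_A(-, N)] reverses the sequence; the left splitting [r] gives surjectivity onto
    [bihom B' N]. *)
Lemma cosyzygy_bihom P B B' N (q : {linear P -> B}) (j : {linear B' -> P}) :
  projective P -> fin_gen P -> projective (lres B) -> fdim (restr N) ->
  surj q -> injective j -> (forall x, q x = 0 <-> exists y, j y = x) ->
  cosyzygy e e' (bihom B N) (bihom B' N).
Proof.
move=> Pproj Pfg Bproj Nfd qsurj jinj exact.
have [r rP] := projective_split Bproj qsurj jinj exact.
exists (bihom P N), (bihom_comp (N := N) (lres_map q)).
exists (bihom_comp (N := N) (lres_map j)).
split.
- exact: rel_proj_bihom.
- by apply: fdim_bihom Nfd; apply: fin_gen_fdim.
- move=> f f' ff'; apply: bihomP => x; have [y <-] := qsurj x.
  exact: (congr1 (fun h : bihom P N => h y) ff').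
- move=> f; exists (bihom_comp r f); apply: bihomP => x.
  by congr (f _); apply: rP.
move=> f; split=> [f0|[g <-]]; last first.
  apply: bihomP => x; rewrite -[RHS](linear0 g); congr (g _).
  by apply/exact; exists x.
have [|g gP] := @factor_epi _ _ _ _ (lres_map q) f qsurj; last first.
  by exists g; apply: bihomP.
move=> x /exact[y <-].
exact: (congr1 (fun h : bihom B' N => h y) f0).
Qed.

Lemma cosyzygy_iso C C' D D' : mod_iso C D -> mod_iso C' D' ->
  cosyzygy e e' C C' -> cosyzygy e e' D D'.
Proof.
move=> [f /linear_inverse[f' [fK f'K]]] [g /linear_inverse[g' [gK g'K]]].
move=> [I [i [p [It Ifd iinj psurj exact]]]].
exists I, (i \o f'), (g \o p); split=> // [x y|y|x] /=.
- by move=> /iinj/(can_inj f'K).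
- by have [x xP] := psurj (g' y); exists x; rewrite /= xP g'K.
split=> [gpx|[y <-]].
  have /exact[y <-] : p x = 0 by rewrite -[LHS]gK gpx linear0.
  by exists (f y); rewrite fK.
suff -> : p (i (f' y)) = 0 by rewrite linear0.
by apply/exact; exists (f' y).
Qed.

Lemma nth_cosyzygy_iso n C C' D D' : mod_iso C D -> mod_iso C' D' ->
  nth_cosyzygy e e' n.+1 C C' -> nth_cosyzygy e e' n.+1 D D'.
Proof.
have refl M : mod_iso M M by exists idfun, id.
elim: n C D => [|n IHn] C D CD CD' [W CW].
  by move=> /= WC'; exists D' => //; rewrite WC' in CW; apply: cosyzygy_iso CW.
move=> WC'; exists W; first by apply: cosyzygy_iso CW.
exact: IHn WC'.
Qed.

Lemma fin_gen_bimod : fin_gen (bimod A : lmodType E).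
Proof.
exists 1%N, (fun=> (1 : A)) => x; exists (fun=> lten (x : A)).
by rewrite big_ord1 /lten ptens_bimodE !mulr1.
Qed.

(** Finite dimension and left projectivity of each syzygy are carried through the induction, since
    the next cosyzygy step requires them. *)
Lemma nth_cosyzygy_syzygy (P : proj_resolution (bimod A : lmodType E)) N n :
  minimal_resolution P -> fdim (restr N) ->
  [/\ fdim (restr (syzygy P n)), projective (lres (syzygy P n)) &
      nth_cosyzygy e e' n (bihom (bimod A) N) (bihom (syzygy P n) N)].
Proof.
move=> Pmin Nfd; elim: n => [|n [fd proj cosyz]].
  split=> //; last exact: projective_lres_bimod.
  exact/fin_gen_fdim/fin_gen_bimod.
have [q [j [qsurj jinj exact /(_ Pmin) sup]]] := syzygy_sequence P n.
(* Minimality is what makes [P n] finitely generated. *)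
have Pfg := superfluous_fin_gen qsurj sup (fdim_fin_gen fd).
have [r rP] := projective_split proj qsurj jinj exact.
split.
- exact: (fdim_sub (jinj : injective (restr_map j)) (fin_gen_fdim Pfg)).
- apply: (projective_retract (j := lres_map j) rP).
  exact: projective_lres (@res_proj _ _ P n) Pfg.
rewrite -addn1; apply/nth_cosyzygyD; exists (bihom (syzygy P n) N) => //.
exists (bihom (syzygy P n.+1) N); last by rewrite addn1.
exact: (cosyzygy_bihom (@res_proj _ _ P n) Pfg proj Nfd qsurj jinj exact).
Qed.

Lemma nth_cosyzygy_periodic : periodic_alg A ->
  exists2 p, (0 < p)%N &
  forall N, fdim (restr N) -> forall r, nth_cosyzygy e e' (r * p) N N.
Proof.
move=> [p p_gt0 [P Pmin ALp]]; exists p => // N Nfd.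
have pN : nth_cosyzygy e e' p N N.
  have [_ _] := nth_cosyzygy_syzygy p Pmin Nfd.
  (* A positive order lets both ends be replaced by [N] up to isomorphism: one by evaluation at 1,
     the other by periodicity as well. *)
  case: p p_gt0 ALp => // p _ [f /linear_inverse[f' [fK f'K]]].
  apply: nth_cosyzygy_iso; first exact: bihom_bimod_iso.
  have [u /linear_inverse[u' [uK u'K]]] := bihom_bimod_iso N.
  have [v /linear_inverse[v' [vK v'K]]] :
      mod_iso (bihom (syzygy P p.+1) N) (bihom (bimod A) N).
    by apply: bihom_iso; exists f', f.
  by exists (u \o v), (v' \o u') => x /=; rewrite ?uK ?vK ?v'K ?u'K.
by elim=> // r IHr; rewrite mulSn; apply/nth_cosyzygyD; exists N.
Qed.
End Cosyzygies.

Lemma Ext_vanishing_symmetry (M N : lmodType A) :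
  symmetric_alg A -> periodic_alg A ->
  fin_gen M -> fin_gen N ->
  (exists n, forall i, (n < i)%N -> Ext_eq0 i M N) ->
  forall i, (0 < i)%N -> Ext_eq0 i N M.
Proof.
move=> /symmetric_dual_bases[lam [e [e' lam_e]]] Aper.
move=> /fin_gen_fdim Mfd /fin_gen_fdim Nfd [n MN] [//|i] _.
have [p p_gt0 cosyz] := nth_cosyzygy_periodic lam_e Aper.
(* [l.+1] must exceed [n] and, together with the [i.+2] steps of the way back, make up a multiple of
   [p]; [n + i.+3] periods suffice as [p] is positive. *)
pose l := ((n + i.+3) * p - i.+3)%N.
have le : (n + i.+3 <= (n + i.+3) * p)%N by rewrite leq_pmulr.
have lE : (l.+1 + i.+2 = (n + i.+3) * p)%N.
  by rewrite addSnnS subnK // (leq_trans _ le) ?leq_addl.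
have ln : (n < l.+1)%N.
  by rewrite ltnS leq_subRL ?(leq_trans _ le) ?leq_addl // addnC.
(* The same total is split in both orders: [N] reaches [C] in its first [l.+1] steps, and [M] is
   reached from [D] in its last [l.+1]. *)
have /nth_cosyzygyD[C NC CN] : nth_cosyzygy e e' (l.+1 + i.+2) N N.
  by rewrite lE; apply: cosyz.
have /nth_cosyzygyD[D MD DM] : nth_cosyzygy e e' (i.+2 + l.+1) M M.
  by rewrite addnC lE; apply: cosyz.
exact: (Ext_symmetry lam_e Mfd DM NC CN (MN _ ln)).
Qed.
End LeftRestriction.

Theorem theorem4p4 (k : fieldType) (A : falgType k)
  (Asym : symmetric_alg A) (Aper : periodic_alg A)
  (Ass : semisimple_ring (tens (radquot A) (radquot A)))
  (M N : lmodType A) (Mfg : fin_gen M) (Nfg : fin_gen N) :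
  [<-> exists n : nat, forall i : nat, (n < i)%N -> Ext_eq0 i M N;
       forall i : nat, (0 < i)%N -> Ext_eq0 i M N;
       exists n : nat, forall i : nat, (n < i)%N -> Ext_eq0 i N M;
       forall i : nat, (0 < i)%N -> Ext_eq0 i N M].
Proof.
have MN := Ext_vanishing_symmetry Asym Aper Mfg Nfg.
have NM := Ext_vanishing_symmetry Asym Aper Nfg Mfg.
(* One use of symmetry turns eventual vanishing into vanishing in all positive degrees with the
   arguments exchanged; a second use exchanges them back. *)
tfae => [/MN NM0|MN0|/NM MN0|NM0].
- by apply: NM; exists 0%N.
- by exists 0%N; apply: MN; exists 0%N.
- by apply: MN; exists 0%N.
- by exists 0%N; apply: NM; exists 0%N.
Qed.
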